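(* Consider a class of functions $(\lambda,\mu)$ with $\lambda:\bar\Omega\to\mathbb{R}^3$ and $\mu:\bar\Omega\to\mathbb{R}^{3\times3}$, such that the difference $(\Delta\lambda,\Delta\mu)$ of any two functions in the class satisfies i) $C^T\nabla\Delta\lambda-\Delta\mu^{(s)}=0$ and $\Delta\mu^{(a)}=0$ on $\partial\Omega_s$; and ii) $\big(CA^{-1}(\Delta\mu^{(s)}-C^T\nabla\Delta\lambda)\big)n=0$ on $\partial\Omega_s$, $\ \Delta\lambda=0$ on $\partial\Omega_u$, $\ \Delta\mu\,n=0$ on $\partial\Omega_s$. When $C$ is positive-definite (major symmetry is not required), there can be at most one solution in this class of functions to the system $$\begin{aligned} &-\operatorname{div}\Big(C\big(\bar E-A^{-1}(\mu^{(s)}-C^T\nabla\lambda)\big)\Big)-b=0 &&\text{on }\Omega,\\ &\nabla(\bar u-\operatorname{div}\mu)-\big(\bar E-A^{-1}(\mu^{(s)}-C^T\nabla\lambda)\big)-(\bar W-\mu^{(a)})=0 &&\text{on }\Omega,\\ &\bar u-\operatorname{div}\mu=u^{(b)} &&\text{on }\partial\Omega_u,\\ &\Big(C\big(\bar E-A^{-1}(\mu^{(s)}-C^T\nabla\lambda)\big)\Big)n=t &&\text{on }\partial\Omega_s,\\ &\lambda=0 &&\text{on }\partial\Omega_u,\\ &\mu n=0 &&\text{on }\partial\Omega_s, \end{aligned}$$ where the last two boundary conditions (on $\lambda$ and on $\mu n$) can be arbitrarily assigned, i.e. their right-hand sides may be any specified functions.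
   Context: $\Omega$ is a given 3-dimensional domain with boundary $\partial\Omega=\overline{\partial\Omega_s\cup\partial\Omega_u}$, the closure of a union of disjoint sets; $n$ is the outward unit normal on $\partial\Omega$. The elastic moduli $C=C(x)$ form a given, possibly spatially varying, fourth-order tensor field with minor symmetries $C_{ijkl}=C_{jikl}=C_{ijlk}$; $(C^T)_{ijkl}:=C_{klij}$; major symmetry means $C=C^T$; positive-definite means $e:Ce>0$ for every nonzero symmetric second-order tensor $e$. $A$ is a specified fourth-order tensor field with major symmetry, positive-definite on the space of symmetric second-order tensors, and $A^{-1}$ is its inverse on that space. The base states $\bar u$ (vector-valued), $\bar E$ (symmetric tensor-valued) and $\bar W$ (antisymmetric tensor-valued) are arbitrarily specified functions on $\Omega$; $b$, $u^{(b)}$, $t$ are the given body force density, boundary displacement and boundary traction. The system is the dual formulation of linear elastostatics, in which the displacement, strain and rotation are represented by $\bar u-\operatorname{div}\mu$, $\bar E-A^{-1}(\mu^{(s)}-C^T\nabla\lambda)$ and $\bar W-\mu^{(a)}$, respectively. Notation: $(\nabla\lambda)_{ij}=\partial_j\lambda_i$, $(C^T\nabla\lambda)_{mn}=C_{ijmn}\partial_j\lambda_i$, $(Ce)_{ij}=C_{ijkl}e_{kl}$, $(\operatorname{div}\mu)_i=\partial_j\mu_{ij}$; $\mu^{(s)}$ and $\mu^{(a)}$ are the symmetric and antisymmetric parts of $\mu$ (and $\Delta\mu^{(s)},\Delta\mu^{(a)}$ those of $\Delta\mu$); '':'' is the inner product of second-order tensors. The result summarizes a formal argument; no function spaces or regularity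 classes are specified.
   Formalization: Ω is assumed bounded, its boundary C¹ off an area-null set, with ∂Ω_s in the smooth part; ∂Ω_u is not contained in a line (else rigid motions break uniqueness); λ, μ, ū−div μ and the stress are C¹ in Ω and continuous up to the boundary. *)

(* Defs.v *)
From mathcomp Require Import all_boot all_order all_algebra.
From mathcomp Require Import all_classical all_reals all_analysis.

Set Implicit Arguments.
Unset Strict Implicit.
Unset Printing Implicit Defensive.

Import Order.TTheory GRing.Theory Num.Theory.
Import numFieldNormedType.Exports.

Local Open Scope classical_set_scope.
Local Open Scope ring_scope.

(* The library norm on matrices is the sup norm.  It is used here only for the
   topology, for boundedness and for coverings by balls; Euclidean lengths are
   written out explicitly. *)
Notation vec R := 'cV[R]_3.
Notation tensor2 R := 'M[R]_3.

Definition tensor4 (R : realType) := 'I_3 -> 'I_3 -> 'I_3 -> 'I_3 -> R.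

Section Tensors.
Variable R : realType.
Implicit Types (C A : tensor4 R) (e : tensor2 R).

Definition tapp C e : tensor2 R :=
  \matrix_(i, j) \sum_(k < 3) \sum_(l < 3) C i j k l * e k l.

Definition ttr C : tensor4 R := fun i j k l => C k l i j.

Definition dot2 (e f : tensor2 R) : R :=
  \sum_(i < 3) \sum_(j < 3) e i j * f i j.

Definition symmetric2 e : Prop := e^T = e.
Definition antisymmetric2 e : Prop := e^T = - e.
Definition sympart e : tensor2 R := 2^-1 *: (e + e^T).
Definition skewpart e : tensor2 R := 2^-1 *: (e - e^T).

Definition minor_symmetric C : Prop :=
  forall i j k l, C i j k l = C j i k l /\ C i j k l = C i j l k.

Definition major_symmetric C : Prop := ttr C = C.

Definition positive_definite C : Prop :=
  forall e, symmetric2 e -> e != 0 -> 0 < dot2 e (tapp C e).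

(* [B] is the inverse of [A] as an operator on symmetric tensors; in
   particular both operators map symmetric tensors to symmetric tensors.  The
   action of [B] on other tensors is irrelevant. *)
Definition inverse_on_sym A (B : tensor4 R) : Prop :=
  forall e, symmetric2 e ->
    [/\ symmetric2 (tapp A e), symmetric2 (tapp B e),
        tapp A (tapp B e) = e & tapp B (tapp A e) = e].

End Tensors.

Section Calculus.
Variable R : realType.

Definition pd (j : 'I_3) (f : vec R -> R) (x : vec R) : R :=
  'D_(delta_mx j 0 : vec R) f x.

Definition sgrad (f : vec R -> R) (x : vec R) : vec R := \col_j pd j f x.

Definition grad (u : vec R -> vec R) (x : vec R) : tensor2 R :=
  \matrix_(i, j) pd j (fun y => u y i 0) x.

Definition div (s : vec R -> tensor2 R) (x : vec R) : vec R :=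
  \col_i \sum_(j < 3) pd j (fun y => s y i j) x.

Definition C1_on (U : set (vec R)) (f : vec R -> R) : Prop :=
  forall x, U x ->
    differentiable f x /\ forall j, {for x, continuous (pd j f)}.

Definition C1_on_mx m n (U : set (vec R)) (f : vec R -> 'M[R]_(m, n)) : Prop :=
  forall i j, C1_on U (fun y => f y i j).

End Calculus.

Section Domain.
Variable R : realType.
Implicit Types (Omega Gamma S : set (vec R)) (x v : vec R).

(* [Omega] is open wherever this is used. *)
Definition boundary Omega : set (vec R) := closure Omega `\` Omega.

(* Near [x] the set [Omega] is the sublevel set [rho < 0] of a C^1 function with
   nonvanishing gradient at the boundary point [x], so [Omega] lies on one side
   of a C^1 surface, and [v] is the outward unit normal there. *)
Definition outward_normal Omega x v : Prop :=
  exists (U : set (vec R)) (rho : vec R -> R),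
    [/\ open U, U x & C1_on U rho] /\
    [/\ forall y, U y -> (Omega y <-> rho y < 0),
        rho x = 0,
        sgrad rho x != 0 &
        v = (Num.sqrt (\sum_(i < 3) sgrad rho x i 0 ^+ 2))^-1 *: sgrad rho x].

Definition regular_boundary Omega : set (vec R) :=
  [set x | exists v, outward_normal Omega x v].

(* Vanishing two-dimensional (spherical) Hausdorff measure. *)
Definition area_null S : Prop :=
  forall eps : R, 0 < eps ->
    exists (c : nat -> vec R) (r : nat -> R),
      [/\ forall k, 0 < r k,
          S `<=` \bigcup_k ball (c k) (r k) &
          forall N : nat, \sum_(k < N) r k ^+ 2 <= eps].

(* A bounded domain whose boundary is C^1 up to an area-null set of edges and
   corners: C^1 domains, polyhedra, piecewise smooth bodies. *)
Definition body Omega : Prop :=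
  [/\ open Omega, connected Omega, bounded_set Omega &
      area_null (boundary Omega `\` regular_boundary Omega)].

Definition collinear Gamma : Prop :=
  exists a d : vec R, forall x, Gamma x -> exists s : R, x = a + s *: d.

(* The normal is needed on [Gs], which therefore consists of regular boundary
   points; edges are reached through the closure.  The prescribed-displacement
   part must contain three non-collinear points, as does any part of positive
   area: if it is contained in a line, infinitesimal rotations about that line
   (all rigid motions, if it is empty) can be added to [lambda]. *)
Definition boundary_partition Omega (Gs Gu : set (vec R)) : Prop :=
  [/\ Gs `<=` regular_boundary Omega, Gu `<=` boundary Omega,
      Gs `&` Gu = set0, boundary Omega = closure (Gs `|` Gu) &
      ~ collinear Gu].

(* Boundary value [l] at [x] of a field given inside [Omega]. *)
Definition bval Omega m n (f : vec R -> 'M[R]_(m.+1, n.+1)) x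
    (l : 'M[R]_(m.+1, n.+1)) : Prop :=
  f y @[y --> within Omega (nbhs x)] --> l.

(* C^1 inside [Omega], with a continuous extension to the closure. *)
Definition C1_ext Omega m n (f : vec R -> 'M[R]_(m.+1, n.+1)) : Prop :=
  C1_on_mx Omega f /\ forall x, boundary Omega x -> exists l, bval Omega f x l.

End Domain.

Section DualElasticity.
Variable R : realType.
Variables (Omega Gs Gu : set (vec R)) (n : vec R -> vec R).
Variables (C Ainv : vec R -> tensor4 R).
Variables (ubar : vec R -> vec R) (Ebar Wbar : vec R -> tensor2 R).
Implicit Types (lam : vec R -> vec R) (mu : vec R -> tensor2 R).

(* mu^(s) - C^T grad lambda *)
Definition sym_mismatch lam mu (x : vec R) : tensor2 R :=
  sympart (mu x) - tapp (ttr (C x)) (grad lam x).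

Definition dual_displacement mu (x : vec R) : vec R := ubar x - div mu x.

Definition dual_strain lam mu (x : vec R) : tensor2 R :=
  Ebar x - tapp (Ainv x) (sym_mismatch lam mu x).

Definition dual_rotation mu (x : vec R) : tensor2 R := Wbar x - skewpart (mu x).

Definition dual_stress lam mu (x : vec R) : tensor2 R :=
  tapp (C x) (dual_strain lam mu x).

(* Classical regularity: exactly the fields which the system differentiates
   are required to be C^1 in [Omega] and continuous up to the boundary.  No
   regularity is asked separately of the moduli or of the base states. *)
Definition classical_pair lam mu : Prop :=
  [/\ C1_on_mx Omega lam /\ {within closure Omega, continuous lam},
      C1_on_mx Omega mu /\ {within closure Omega, continuous mu},
      C1_ext Omega (dual_displacement mu) &
      C1_ext Omega (dual_stress lam mu)].

(* In tractions the normal is that of the boundary point at which the boundary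
   value is taken. *)
Definition difference_conditions dlam dmu : Prop :=
  [/\ forall x, Gs x ->
        bval Omega (fun y => tapp (ttr (C y)) (grad dlam y) - sympart (dmu y))
          x 0 /\
        skewpart (dmu x) = 0,
      forall x, Gs x ->
        bval Omega
          (fun y => tapp (C y) (tapp (Ainv y) (sym_mismatch dlam dmu y)) *m n x)
          x 0,
      forall x, Gu x -> dlam x = 0 &
      forall x, Gs x -> dmu x *m n x = 0].

(* [lamb] and [tau] are the freely assigned boundary data for the dual fields;
   zero is the standard choice. *)
Definition dual_solution (b ub t lamb tau : vec R -> vec R) lam mu : Prop :=
  [/\ forall x, Omega x -> - div (dual_stress lam mu) x - b x = 0 &
      forall x, Omega x ->
        grad (dual_displacement mu) x - dual_strain lam mu x
          - dual_rotation mu x = 0] /\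
  [/\ forall x, Gu x -> bval Omega (dual_displacement mu) x (ub x),
      forall x, Gs x ->
        bval Omega (fun y => dual_stress lam mu y *m n x) x (t x),
      forall x, Gu x -> lam x = lamb x &
      forall x, Gs x -> mu x *m n x = tau x].

End DualElasticity.

(* Main.v *)
Require Import Defs.
From mathcomp Require Import all_boot all_order all_algebra.
From mathcomp Require Import all_classical all_reals all_analysis.
From mathcomp Require Import ring lra.
Import Order.TTheory GRing.Theory Num.Theory.
Import numFieldNormedType.Exports.
Local Open Scope classical_set_scope.
Local Open Scope ring_scope.
Set Implicit Arguments.
Unset Strict Implicit.
Unset Printing Implicit Defensive.

(** The difference of two solutions satisfies the homogeneous problem, and two
    applications of the same energy identity show that it vanishes.

    Let [d], [E] and [s = C E] be the differences of the displacements, strains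
    and stresses represented by the two pairs.  Then [s] is symmetric and
    divergence free, [grad d] is [E] up to a skew tensor, [d] vanishes on [Gu]
    and [s n] on [Gs], so that the integral of [E : C E] is that of
    [div (s^T d)], a boundary integral which is zero ([energy_vanishes]).
    Hence [E = 0], [grad d] is skew, [d] is a rigid motion which vanishes at
    three non-collinear points, and [d = 0] ([skew_grad_eq0]).  It follows that
    the skew part of the difference [dmu] is zero, that [dmu] is divergence
    free, and, [A^-1] being injective on symmetric tensors, that
    [dmu = C^T grad dlam].  As [dlam = 0] on [Gu] and [dmu n = 0] on [Gs], the
    energy identity applies to [dlam] and [dmu], with energy density
    [grad dlam : C^T grad dlam = grad dlam : C grad dlam]; thus [grad dlam] is
    skew, [dlam = 0] and [dmu = 0].

    The analytic core is [divergence_vanishes]: if [F] is C^1 in [Omega],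
    bounded, has nonnegative divergence and no normal component at the regular
    boundary points, then [div F = 0].  The divergence is not known to be
    integrable, the boundary is only C^1 up to an area-null set, and no surface
    integral is used.  For a C^1 cutoff [chi] vanishing near the boundary and
    equal to 1 on a given ball, the integral of [div (chi F)] is zero, so that of
    [chi div F] is at most that of [|F . grad chi|]; it suffices to make the
    latter, the cost of [chi], arbitrarily small.  Near a regular boundary point
    ([barrier_regular]) [chi] is a function of the local defining function [rho],
    which varies in a layer of thickness of order [e] with slope of order [1 / e]
    in the normal direction, where [F] is small.  The exceptional set is covered
    by balls of radii [r k], at a cost of order [r k ^+ 2] each ([barrier_ball]).
    Costs add up under products of cutoffs ([barrierU]), and the boundary is
    compact ([barrier_boundary]).

    Integrals are replaced by means over the nodes of finer and finer regular
    grids: sums of partial derivatives telescope approximately along the lines of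
    the grid ([mean_pd_le]), and the few volumes that occur are estimated by
    counting nodes ([upmean_thin], [upmean_ball], [mean_ball_ge]). *)

(** * Compactness and finite sums *)

Section Compactness.
Variable R : realType.
Implicit Types (x y : vec R).

Lemma vec_norm_lt x (e : R) : 0 < e -> (`|x| < e) = [forall i, `|x i 0| < e].
Proof.
move=> e0; apply/idP/forallP => [xe i|xe].
  apply: le_lt_trans xe; rewrite [leRHS]/Num.norm /= mx_normrE.
  by apply/bigmax_geP; right => /=; exists (i, 0).
rewrite /Num.norm /= mx_normrE; apply/bigmax_ltP; split=> //= -[i j] _.
by rewrite [j]ord1; exact: xe.
Qed.

Lemma vec_coord_le x i : `|x i 0| <= `|x|.
Proof.
rewrite [leRHS]/Num.norm /= mx_normrE.
by apply/bigmax_geP; right => /=; exists (i, 0).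
Qed.

Lemma vec_norm_le x (e : R) : 0 <= e -> (forall i, `|x i 0| <= e) -> `|x| <= e.
Proof.
move=> e0 xe; rewrite /Num.norm /= mx_normrE.
by apply/bigmax_leP; split=> //= -[i j] _; rewrite [j]ord1; exact: xe.
Qed.

Lemma bounded_closed_compact_vec (K : set (vec R)) :
  bounded_set K -> closed K -> compact K.
Proof.
move=> bK cK.
have trc m n : continuous (fun A : 'M[R]_(m, n) => A^T).
  move=> A s /= /nbhs_ballP[e e0 es]; apply/nbhs_ballP; exists e => //= B [_ AB].
  by apply: es; split=> // i j; rewrite !mxE; exact: AB.
have -> : K = (fun A : 'rV[R]_3 => A^T) @` ((fun A : 'rV[R]_3 => A^T) @^-1` K).
  apply/seteqP; split=> [x Kx|_ [y Ky <-]//].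
  by exists x^T; rewrite /= ?trmxK.
apply: continuous_compact; first exact/continuous_subspaceT/trc.
apply: bounded_closed_compact; last first.
  by apply: closed_comp => // x _; exact: trc.
case: bK => B [Br KB]; exists B; split=> // b Bb x Kx.
apply: le_trans (KB _ Bb _ Kx).
rewrite /Num.norm/= !mx_normrE; apply/bigmax_leP; split=> [|[i j] _].
  exact: bigmax_ge_id.
by apply/bigmax_geP; right => /=; exists (j, i); rewrite //= mxE.
Qed.

Lemma open_far (c : vec R) (r : R) : open [set y : vec R | r < `|y - c|].
Proof.
rewrite (_ : [set y | _] = (fun y : vec R => `|y - c|) @^-1` [set t | r < t])//.
apply: open_comp; last exact: open_gt.
move=> y _; apply: continuous_comp; last exact: norm_continuous.
by apply: continuousB => //; exact: cst_continuous.
Qed.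

End Compactness.

Lemma cvg_finite_sum (R : realType) (T I : Type) (F : set_system T) (l : seq I)
    (f : I -> T -> R) (a : I -> R) : Filter F ->
  (forall i, f i x @[x --> F] --> a i) ->
  \sum_(i <- l) f i x @[x --> F] --> \sum_(i <- l) a i.
Proof.
move=> FF fa; elim: l => [|i l IH].
  by rewrite big_nil; under eq_fun do rewrite big_nil; exact: cvg_cst.
by rewrite big_cons; under eq_fun do rewrite big_cons; exact: cvgD.
Qed.

(** * Calculus of C^1 functions *)

Lemma near_eq_differentiable (R : realType) (V W : normedModType R)
    (f g : V -> W) (x : V) : (\forall y \near x, f y = g y) ->
  differentiable g x -> differentiable f x.
Proof.
move=> fg dg; suff de : differentiable (fun y => f y - g y) x.
  have -> : f = (fun y => f y - g y) + g by apply/funext => y; rewrite /= !fctE subrK.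
  exact: differentiableD.
set e := fun y => _; have e0 : \forall h \near (0 : V), e (h + x) = 0.
  have /nbhs_ballP[r r0 xr] := fg; apply/nbhs_ballP; exists r => // h.
  rewrite -!ball_normE /= sub0r normrN => hr; rewrite /e xr ?subrr//.
  by rewrite -ball_normE /= opprD addrCA subrr addr0 normrN.
have elin : e \o shift x = cst (e x) + (\0 : {linear V -> W}) +o_ 0 id.
  apply/eqaddoP => _/posnumP[r]; near=> h.
  rewrite /= !fctE /= (near e0 h)//= [e x](_ : _ = 0) ?addr0 ?subrr ?normr0 ?mulr_ge0//.
  by have := nbhs_singleton e0; rewrite add0r.
have ed : 'd e x = \0 :> (V -> W) by apply: diff_unique => //; exact: cst_continuous.
apply/diff_locallyP; split; first by rewrite ed; exact: cst_continuous.
by rewrite ed elin.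
Unshelve. all: by end_near. Qed.


Section C1Calculus.
Variable R : realType.
Implicit Types (x y : vec R) (f g : vec R -> R) (U : set (vec R)).

Lemma C1_on_sub (U V : set (vec R)) f : V `<=` U -> C1_on U f -> C1_on V f.
Proof. by move=> VU fU x /VU/fU. Qed.

Lemma C1_on_continuous U f x : C1_on U f -> U x -> {for x, continuous f}.
Proof. by move=> fU /fU[/differentiable_continuous]. Qed.


Lemma pd_cst j (c : R) x : pd j (cst c) x = 0.
Proof. exact: derive_cst. Qed.

Lemma pdD j f g x : differentiable f x -> differentiable g x ->
  pd j (fun y => f y + g y) x = pd j f x + pd j g x.
Proof. by move=> df dg; apply: deriveD; exact: diff_derivable. Qed.

Lemma pdB j f g x : differentiable f x -> differentiable g x ->
  pd j (fun y => f y - g y) x = pd j f x - pd j g x.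
Proof. by move=> df dg; apply: deriveB; exact: diff_derivable. Qed.

Lemma pdM j f g x : differentiable f x -> differentiable g x ->
  pd j (fun y => f y * g y) x = f x * pd j g x + g x * pd j f x.
Proof. by move=> df dg; apply: deriveM; exact: diff_derivable. Qed.

Lemma pd_comp j (q : R -> R) f x : differentiable f x -> derivable q (f x) 1 ->
  pd j (fun y => q (f y)) x = derive1 q (f x) * pd j f x.
Proof.
move=> df dq; have dq' : differentiable q (f x) by exact/derivable1_diffP.
rewrite /pd (deriveE _ (differentiable_comp df dq')) diff_comp //= deriv1E //=.
by rewrite -deriveE // mulrC.
Qed.


Lemma near_eq_pd j f g x : (\forall y \near x, f y = g y) ->
  pd j f x = pd j g x.
Proof. exact: near_eq_derive. Qed.

(** Serves to glue cutoffs from pieces given on overlapping open sets. *)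
Lemma C1_on_local U f : (forall x, U x -> exists (V : set (vec R)) g,
    [/\ open V, V x, C1_on V g & forall y, V y -> f y = g y]) -> C1_on U f.
Proof.
move=> loc x /loc[V [g [oV Vx gV fg]]]; have [dg cg] := gV x Vx.
have fgV y : V y -> \forall z \near y, f z = g z.
  by move=> Vy; near=> z; apply: fg; near: z; exact: open_nbhs_nbhs.
split; first exact: near_eq_differentiable (fgV _ Vx) dg.
move=> j; have pdfg : \forall y \near x, pd j g y = pd j f y.
  near=> y; apply/esym/near_eq_pd/fgV; near: y; exact: open_nbhs_nbhs.
rewrite /prop_for /continuous_at -(nbhs_singleton pdfg).
exact: cvg_trans (near_eq_cvg pdfg) (cg j).
Unshelve. all: by end_near. Qed.

Lemma C1_on_cst U c : C1_on U (cst c).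
Proof.
move=> x _; split=> // j; rewrite (_ : pd j (cst c) = cst 0).
  exact: cst_continuous.
by apply/funext => y; exact: pd_cst.
Qed.


(** A formula [h] for the partial derivatives holds on [U] only; as [U] is open
    it holds near every point of [U], so that it also decides continuity. *)
Lemma C1_on_pdE U f (h : 'I_3 -> vec R -> R) : open U ->
  (forall x, U x -> differentiable f x) ->
  (forall j x, U x -> pd j f x = h j x) ->
  (forall j x, U x -> {for x, continuous (h j)}) -> C1_on U f.
Proof.
move=> oU df fh ch x Ux; split=> [|j]; first exact: df.
have near_fh : \forall y \near x, h j y = pd j f y.
  by near=> y; apply/esym/fh; near: y; exact: open_nbhs_nbhs.
rewrite /prop_for /continuous_at -(nbhs_singleton near_fh).
exact: cvg_trans (near_eq_cvg near_fh) (ch j x Ux).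
Unshelve. all: by end_near. Qed.

Lemma C1_onD U f g : open U -> C1_on U f -> C1_on U g ->
  C1_on U (fun y => f y + g y).
Proof.
move=> oU fU gU.
apply: (C1_on_pdE (h := fun j y => pd j f y + pd j g y)) => // [x Ux|j x Ux|j x Ux];
  have [df cf] := fU x Ux; have [dg cg] := gU x Ux.
- exact: differentiableD.
- exact: pdD.
- exact: continuousD.
Qed.

Lemma C1_onB U f g : open U -> C1_on U f -> C1_on U g ->
  C1_on U (fun y => f y - g y).
Proof.
move=> oU fU gU.
apply: (C1_on_pdE (h := fun j y => pd j f y - pd j g y)) => // [x Ux|j x Ux|j x Ux];
  have [df cf] := fU x Ux; have [dg cg] := gU x Ux.
- exact: differentiableB.
- exact: pdB.
- exact: continuousB.
Qed.

Lemma C1_onM U f g : open U -> C1_on U f -> C1_on U g ->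
  C1_on U (fun y => f y * g y).
Proof.
move=> oU fU gU.
apply: (C1_on_pdE (h := fun j y => f y * pd j g y + g y * pd j f y)) => //
  [x Ux|j x Ux|j x Ux]; have [df cf] := fU x Ux; have [dg cg] := gU x Ux.
- exact: differentiableM.
- exact: pdM.
- by apply: continuousD; apply: continuousM => //; exact: differentiable_continuous.
Qed.

Lemma C1_on_comp U (q : R -> R) f : open U -> C1_on U f ->
  (forall s, derivable q s 1) -> continuous (derive1 q) ->
  C1_on U (fun y => q (f y)).
Proof.
move=> oU fU dq cq.
apply: (C1_on_pdE (h := fun j y => derive1 q (f y) * pd j f y)) => //
  [x Ux|j x Ux|j x Ux]; have [df cf] := fU x Ux.
- by apply: differentiable_comp => //; exact/derivable1_diffP.
- exact: pd_comp.
- apply: continuousM => //; apply: continuous_comp; last exact: cq.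
  exact: differentiable_continuous.
Qed.

Lemma pd_coord i j x : pd j (fun y => y i 0) x = (i == j)%:R.
Proof.
have /(congr1 (fun A : vec R => A i 0)) := derive_mx (@derivable_id _ _ x (delta_mx j 0 : vec R)).
by rewrite derive_id !mxE eqxx andbT /pd => ->.
Qed.

Lemma C1_on_coord U i : open U -> C1_on U (fun y => y i 0).
Proof.
move=> oU; apply: (C1_on_pdE (h := fun j => cst (i == j)%:R)) => // [x _|j x _|j x _].
- exact: differentiable_coord.
- exact: pd_coord.
- exact: cst_continuous.
Qed.

Lemma C1_on_sum (I : Type) (r : seq I) U (F : I -> vec R -> R) : open U ->
  (forall i, C1_on U (F i)) -> C1_on U (fun y => \sum_(i <- r) F i y).
Proof.
move=> oU FU; elim: r => [|i r IH].
  under eq_fun do rewrite big_nil; exact: C1_on_cst.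
under eq_fun do rewrite big_cons; exact: C1_onD.
Qed.

Lemma C1_on_prod (I : Type) (r : seq I) U (F : I -> vec R -> R) : open U ->
  (forall i, C1_on U (F i)) -> C1_on U (fun y => \prod_(i <- r) F i y).
Proof.
move=> oU FU; elim: r => [|i r IH].
  under eq_fun do rewrite big_nil; exact: C1_on_cst.
under eq_fun do rewrite big_cons; exact: C1_onM.
Qed.

End C1Calculus.

(** * One-variable cutoffs and bumps *)

Section Cutoffs.
Variable R : realType.
Implicit Types (s t : R).

(** Squaring the positive part makes it C^1; the cutoffs are composed of this
    function, polynomials and defining functions of the boundary. *)
Definition possq s : R := Num.max s 0 ^+ 2.

(** A quadratic remainder that is uniform in the sign of [s], hence gives the
    derivative at the kink as well. *)
Lemma possq_taylor s h :
  `|possq (h + s) - possq s - 2 * Num.max s 0 * h| <= h ^+ 2.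
Proof.
rewrite /possq ler_norml; case: (leP (h + s) 0); case: (leP s 0) => *; nra.
Qed.

Lemma is_derive_possq s : is_derive s 1 possq (2 * Num.max s 0).
Proof.
have lim : h^-1 *: (possq (h *: 1 + s) - possq s) @[h --> 0^'] --> 2 * Num.max s 0.
  apply/cvgrPdist_le => /= e e0; near=> h.
  have h0 : h != 0 by near: h; exact: nbhs_dnbhs_neq.
  have he : `|h| <= e by near: h; exact: dnbhs0_le.
  apply: le_trans he; rewrite -(@ler_pM2l _ `|h|) ?normr_gt0// -normrM -expr2 real_normK ?num_real//.
  have -> : h * (2 * Num.max s 0 - h^-1 *: (possq (h *: 1 + s) - possq s)) =
      - (possq (h + s) - possq s - 2 * Num.max s 0 * h).
    rewrite scaler1 mulrBr mulrA [h * (_ *: _)](mulVKf h0).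
    by ring.
  by rewrite normrN; exact: possq_taylor.
by split; [apply/cvg_ex; eexists; exact: lim | exact/cvg_lim].
Unshelve. all: by end_near. Qed.

Lemma derivable_possq s : derivable possq s 1.
Proof. by have [] := is_derive_possq s. Qed.

Lemma derive1_possq : derive1 possq = fun s => 2 * Num.max s 0.
Proof. by apply/funext => s; rewrite derive1E (@derive_val _ _ _ _ _ _ _ (is_derive_possq s)). Qed.

Lemma continuous_derive1_possq : continuous (derive1 possq).
Proof.
rewrite derive1_possq => s; apply: cvgM; first exact: cvg_cst.
apply: continuous_max; [exact: cvg_id|exact: cvg_cst].
Qed.

Lemma possq_le0 s : s <= 0 -> possq s = 0.
Proof. by move=> s0; rewrite /possq max_r ?expr0n. Qed.

Lemma possq_ge0 s : 0 <= possq s.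
Proof. exact: sqr_ge0. Qed.

Lemma possq_le1 s : s <= 1 -> possq s <= 1.
Proof. by move=> s1; rewrite /possq exprn_ile1// ?le_max ?lexx ?orbT// ge_max s1 ler01. Qed.

Lemma possq1 : possq 1 = 1.
Proof. by rewrite /possq max_l ?expr1n. Qed.

Lemma possq_ge1 s : 1 <= s -> 1 <= possq s.
Proof. by move=> s1; rewrite /possq max_l ?exprn_ege1// (le_trans _ s1). Qed.

(** A C^1 step: 1 up to [s = 1], 0 from [s = 2] on. *)
Definition step s : R := possq (1 - possq (s - 1)).

Lemma step01 s : 0 <= step s <= 1.
Proof. by rewrite possq_ge0 possq_le1// gerBl possq_ge0. Qed.

Lemma step_le1 s : s <= 1 -> step s = 1.
Proof. by move=> s1; rewrite /step (@possq_le0 (s - 1)) ?subr_le0// subr0 possq1. Qed.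

Lemma step_ge2 s : 2 <= s -> step s = 0.
Proof. by move=> s2; apply: possq_le0; rewrite subr_le0 possq_ge1//; lra. Qed.

Let is_derive_step s : is_derive s 1 step
  (- (2 * Num.max (1 - possq (s - 1)) 0) * (2 * Num.max (s - 1) 0)).
Proof.
have ds : is_derive s 1 (fun s => s - 1) (1 - 0) by apply: is_deriveB.
have dp := is_derive_possq (s - 1).
have d1 := @is_derive1_comp R possq (fun s => s - 1) s _ _ dp ds.
have d2 : is_derive s 1 (fun s => 1 - possq (s - 1)) _ := is_deriveB (is_derive_cst (1 : R) s 1) d1.
have d3 := @is_derive1_comp R possq (fun s => 1 - possq (s - 1)) s _ _ (is_derive_possq _) d2.
by apply: is_derive_eq d3 _; rewrite subr0 sub0r mulr1; ring.
Qed.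

Lemma derivable_step s : derivable step s 1.
Proof. by have [] := is_derive_step s. Qed.

Let derive1_step s : derive1 step s =
  - (2 * Num.max (1 - possq (s - 1)) 0) * (2 * Num.max (s - 1) 0).
Proof. by rewrite derive1E (@derive_val _ _ _ _ _ _ _ (is_derive_step s)). Qed.

Lemma continuous_derive1_step : continuous (derive1 step).
Proof.
rewrite (_ : derive1 step = fun s =>
    - derive1 possq (1 - possq (s - 1)) * derive1 possq (s - 1)); last first.
  by apply/funext => s; rewrite derive1_step !derive1_possq.
have cpossq : continuous possq.
  by move=> s; apply/differentiable_continuous/derivable1_diffP/derivable_possq.
have cs : continuous (fun s : R => s - 1).
  by move=> s; apply: continuousB => //; exact: cst_continuous.
move=> s; apply: cvgM.
  apply: cvgN; apply: (@continuous_comp _ _ _ (fun s => 1 - possq (s - 1))).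
    apply: continuousB; first exact: cst_continuous.
    by apply: (@continuous_comp _ _ _ (fun s => s - 1)); [exact: cs|exact: cpossq].
  exact: continuous_derive1_possq.
by apply: (@continuous_comp _ _ _ (fun s => s - 1)); [exact: cs|exact: continuous_derive1_possq].
Qed.

Lemma derive1_step_bound s : `|derive1 step s| <= 4.
Proof.
rewrite derive1_step; have := possq_ge0 (s - 1).
have [s2|s2] := leP 2 s.
  rewrite (@max_r _ _ _ 0) ?subr_le0 ?possq_ge1//; last lra.
  by move=> _; rewrite mulr0 oppr0 mul0r normr0.
move=> p0; rewrite normrM normrN (_ : 4 = 2 * 2 :> R); last by ring.
by apply: ler_pM => //; rewrite normrM ger0_norm// ger_pMr// ger0_norm ?le_max ?lexx ?orbT// ge_max ?ler01; lra.
Qed.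

End Cutoffs.

Section Bumps.
Variable R : realType.
Implicit Types (x y c : vec R) (s t r : R).

(** The factors are at most 1, so the slopes simply add. *)
Lemma pd_prod_bound (I : Type) (l : seq I) (F : I -> vec R -> R) j x :
  (forall i, differentiable (F i) x) -> (forall i y, 0 <= F i y <= 1) ->
  differentiable (fun y => \prod_(i <- l) F i y) x /\
  `|pd j (fun y => \prod_(i <- l) F i y) x| <= \sum_(i <- l) `|pd j (F i) x|.
Proof.
move=> dF F01; have prod01 (m : seq I) y : 0 <= \prod_(i <- m) F i y <= 1.
  by apply/andP; split; [apply: prodr_ge0 => i _|apply: prodr_ile1 => i _ //]; have /andP[] := F01 i y.
elim: l => [|i l [dl IH]].
  under eq_fun do rewrite big_nil; rewrite big_nil; split=> //.
  by rewrite [pd _ _ _](@pd_cst R) normr0.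
under eq_fun do rewrite big_cons; rewrite big_cons; split.
  exact: differentiableM.
rewrite pdM// addrC; apply: le_trans (ler_normD _ _) _.
have /andP[F0 F1] := F01 i x; have /andP[p0 p1] := prod01 l x.
rewrite !normrM (ger0_norm F0) (ger0_norm p0).
by apply: lerD; [exact: ler_piMl|apply: le_trans IH; exact: ler_piMl].
Qed.

(** The bump is a product of steps in the single coordinates, which is why it is
    adapted to balls of the sup norm; [step] is applied to both signs of each
    coordinate since the absolute value is not differentiable. *)
Lemma bump_exists c r : 0 < r -> exists psi : vec R -> R,
  [/\ C1_on setT psi, forall x, 0 <= psi x <= 1,
      forall x, `|x - c| <= r -> psi x = 1,
      forall x, 2 * r <= `|x - c| -> psi x = 0 &
      forall j x, `|pd j psi x| <= 8 / r].
Proof.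
move=> r0; have oT : open [set: vec R] by exact: openT.
pose f (i : 'I_3) (e : R) x := step (e / r * (x i 0 - c i 0)).
pose lin (i : 'I_3) (e : R) x := e / r * (x i 0 - c i 0).
have C1lin i e : C1_on setT (lin i e).
  apply: C1_onM => //; first exact: C1_on_cst.
  by apply: C1_onB => //; [exact: C1_on_coord|exact: C1_on_cst].
have pdlin i e j x : pd j (lin i e) x = e / r * (i == j)%:R.
  have d1 : differentiable (fun y : vec R => y i 0) x by exact: differentiable_coord.
  have d2 : differentiable (fun y : vec R => y i 0 - c i 0) x by exact: differentiableB.
  by rewrite /lin pdM// pdB// pd_coord !(@pd_cst R) subr0 mulr0 addr0.
have C1f i e : C1_on setT (f i e).
  apply: (@C1_on_comp R setT (@step R) (lin i e)) => //; first exact: derivable_step.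
  exact: continuous_derive1_step.
have pdf i e j x : `|e| = 1 -> `|pd j (f i e) x| <= 4 / r * (i == j)%:R.
  move=> e1; rewrite (@pd_comp _ j (@step R) (lin i e)); last 2 first.
  - by have [] := C1lin i e x I.
  - exact: derivable_step.
  rewrite pdlin !normrM e1 mul1r normr_nat normfV (ger0_norm (ltW r0)) mulrA.
  by rewrite ler_wpM2r// ler_wpM2r ?invr_ge0 ?(ltW r0)//; exact: derive1_step_bound.
pose F i x := f i 1 x * f i (-1) x.
have f01 i e x : 0 <= f i e x <= 1 by exact: step01.
have F01 i x : 0 <= F i x <= 1.
  by have /andP[? ?] := f01 i 1 x; have /andP[? ?] := f01 i (-1) x; rewrite mulr_ge0//= mulr_ile1.
have C1F i : C1_on setT (F i) by exact: C1_onM.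
have pdF i j x : `|pd j (F i) x| <= 8 / r * (i == j)%:R.
  rewrite pdM; last 2 first.
  - by have [] := C1f i 1 x I.
  - by have [] := C1f i (-1) x I.
  apply: le_trans (ler_normD _ _) _; rewrite (normrM (f i 1 x)) (normrM (f i (-1) x)).
  rewrite (_ : 8 = 4 + 4 :> R); last by ring.
  rewrite mulrDl mulrDl; apply: lerD.
    apply: le_trans (pdf i (-1) j x (normrN1 _)); have /andP[f0 f1] := f01 i 1 x.
    by rewrite (ger0_norm f0) ler_piMl.
  apply: le_trans (pdf i 1 j x (normr1 _)); have /andP[f0 f1] := f01 i (-1) x.
  by rewrite (ger0_norm f0) ler_piMl.
have rV1 : 0 < r^-1 by rewrite invr_gt0.
exists (fun x => \prod_i F i x); split.
- exact: C1_on_prod.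
- by move=> x; apply/andP; split; [apply: prodr_ge0 => i _|apply: prodr_ile1 => i _ //]; have /andP[] := F01 i x.
- move=> x xc; apply: big1 => i _; rewrite /F /f.
  have : `|(x - c) i 0| <= r by apply: le_trans (vec_coord_le _ _) xc.
  rewrite !mxE ler_norml => /andP[x1 x2].
  by rewrite !step_le1 ?mulr1// mulrAC ler_pdivrMr//; lra.
- move=> x xc; have [i ri] : exists i, 2 * r <= `|(x - c) i 0|.
    apply: contrapT => /forallNP h; move: xc; apply/negP; rewrite -ltNge.
    rewrite vec_norm_lt; last by rewrite mulr_gt0.
    by apply/forallP => i; rewrite ltNge; exact/negP/h.
  rewrite (bigD1 i)//= /F /f; move: ri; rewrite !mxE.
  have [xi|xi] := leP 0 (x i 0 - c i 0) => ri.
    by rewrite step_ge2 ?mul0r// mulrAC ler_pdivlMr// mul1r -(ger0_norm xi).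
  by rewrite (@step_ge2 R (-1 / r * _)) ?mulr0 ?mul0r// mulrAC ler_pdivlMr// mulN1r -(ltr0_norm xi).
- move=> j x; have [|//|_] := @pd_prod_bound _ (index_enum 'I_3) F j x.
    by move=> i; have [] := C1F i x I.
  move=> h; apply: le_trans h _; rewrite (bigD1 j)//= big1 ?addr0.
    by apply: le_trans (pdF j j x) _; rewrite eqxx mulr1.
  by move=> i ij; apply/eqP; rewrite eq_le normr_ge0 andbT; apply: le_trans (pdF i j x) _; rewrite (negbTE ij) mulr0.
Qed.

End Bumps.

(** * Mean value theorem along lines *)

Section Lines.
Variable R : realType.
Implicit Types (x y v : vec R) (f : vec R -> R) (s t : R).

Lemma is_derive_line f x v t : derivable f (x + t *: v) v ->
  is_derive t 1 (fun s : R => f (x + s *: v)) ('D_v f (x + t *: v)).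
Proof.
move=> df.
have E : (fun h : R => h^-1 *: ((fun s => f (x + s *: v)) (h *: 1 + t) - f (x + t *: v))) =
    (fun h : R => h^-1 *: (f (h *: v + (x + t *: v)) - f (x + t *: v))).
  by apply/funext => h; rewrite scaler1 scalerDl addrCA.
split; first by move: df; rewrite /derivable /= -E.
by rewrite /derive /= -E.
Qed.

Lemma line_MVT f x v s t : s < t ->
  (forall z, s <= z <= t -> differentiable f (x + z *: v)) ->
  exists2 z, s < z < t & f (x + t *: v) - f (x + s *: v) = 'D_v f (x + z *: v) * (t - s).
Proof.
move=> st df.
have dl z : s <= z <= t -> is_derive z 1 (fun s : R => f (x + s *: v)) ('D_v f (x + z *: v)).
  by move=> /df dz; apply: is_derive_line; exact: diff_derivable.
have [z| |z zst E] := @MVT R (fun z => f (x + z *: v)) (fun z => 'D_v f (x + z *: v)) s t st.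
- by rewrite in_itv /= => /andP[sz zt]; apply: dl; rewrite !ltW.
- apply: derivable_within_continuous => z; rewrite in_itv /= => zst.
  by have [] := dl z zst.
- by exists z => //; move: zst; rewrite in_itv.
Qed.

Definition set_coord x (j : 'I_3) t : vec R := \col_i (if i == j then t else x i 0).

Lemma set_coordE x j s t : set_coord x j t = set_coord x j s + (t - s) *: (delta_mx j 0 : vec R).
Proof.
apply/colP => i; rewrite !mxE eqxx andbT.
by case: eqP => _; rewrite ?mulr1 ?mulr0 ?addr0// addrC subrK.
Qed.

Lemma set_coord_MVT f x j s t : s < t ->
  (forall z, s <= z <= t -> differentiable f (set_coord x j z)) ->
  exists2 z, s < z < t & f (set_coord x j t) - f (set_coord x j s) = pd j f (set_coord x j z) * (t - s).
Proof.
move=> st df; have E z : set_coord x j z = (set_coord x j 0) + z *: (delta_mx j 0 : vec R).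
  by rewrite (set_coordE _ _ 0) subr0.
have [|z zst fst] := @line_MVT f (set_coord x j 0) (delta_mx j 0) s t st.
  by move=> z zst; rewrite -E; exact: df.
by exists z => //; rewrite (E t) (E s) (E z).
Qed.

End Lines.

(** * Means over grids *)

Section Grid.
Variables (R : realType) (M : R).
Hypothesis M0 : 0 < M.
Implicit Types (x y : vec R) (g : vec R -> R) (N : nat).

Definition node N (a : nat) : R := - M + 2 * M / N%:R * a%:R.

Definition pt3 (s t u : R) : vec R := \col_i [:: s; t; u]`_i.

(** A Riemann sum, normalized by the volume of the cube of half-side [M]. *)
Definition mean N g : R := (N%:R ^+ 3)^-1 *
  \sum_(a < N) \sum_(b < N) \sum_(c < N) g (pt3 (node N a) (node N b) (node N c)).

Lemma mean_le N g g' : (forall x, g x <= g' x) -> mean N g <= mean N g'.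
Proof.
move=> gg'; rewrite ler_wpM2l ?invr_ge0 ?exprn_ge0//.
by do 3! (apply: ler_sum => ? _).
Qed.

Lemma meanD N g g' : mean N (fun x => g x + g' x) = mean N g + mean N g'.
Proof.
rewrite -mulrDr -big_split; congr (_ * _); apply: eq_bigr => a _.
by rewrite -big_split; apply: eq_bigr => b _; rewrite -big_split.
Qed.

Lemma meanZ N k g : mean N (fun x => k * g x) = k * mean N g.
Proof.
rewrite /mean mulrCA; congr (_ * _); rewrite mulr_sumr; apply: eq_bigr => a _.
by rewrite mulr_sumr; apply: eq_bigr => b _; rewrite mulr_sumr.
Qed.

(** Fubini for the grid: a bound on all sums over lines of one direction bounds
    the mean. *)
Lemma mean_line N g (j : 'I_3) B : (0 < N)%N ->
  (forall x, \sum_(a < N) g (set_coord x j (node N a)) <= B) -> mean N g <= B / N%:R.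
Proof.
move=> N0 gB; have N0' : N%:R != 0 :> R by rewrite pnatr_eq0 -lt0n.
suff gB2 : \sum_(a < N) \sum_(b < N) \sum_(c < N) g (pt3 (node N a) (node N b) (node N c))
    <= N%:R ^+ 2 * B.
  rewrite /mean ler_pdivrMl ?exprn_gt0 ?ltr0n//; apply: le_trans gB2 _.
  by rewrite (_ : _ * (B / _) = N%:R ^+ 2 * B)//; field.
have cst2 : \sum_(a < N) \sum_(b < N) B = N%:R ^+ 2 * B.
  by rewrite !sumr_const !card_ord -mulrnA -[LHS]mulr_natl natrM expr2.
rewrite -{}cst2.
have line x (p : R -> vec R) : (forall t, p t = set_coord x j t) ->
    \sum_(a < N) g (p (node N a)) <= B.
  by move=> px; under eq_bigr do rewrite px; exact: gB.
case: j gB line => -[|[|[|//]]] i gB line.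
- rewrite exchange_big; apply: ler_sum => b _ /=.
  rewrite exchange_big; apply: ler_sum => c _ /=.
  apply: (line (pt3 0 (node N b) (node N c)) (fun t => pt3 t (node N b) (node N c))) => t.
  by apply/colP => -[[|[|[|//]]]] k; rewrite !mxE.
- apply: ler_sum => a _; rewrite exchange_big; apply: ler_sum => c _ /=.
  apply: (line (pt3 (node N a) 0 (node N c)) (fun t => pt3 (node N a) t (node N c))) => t.
  by apply/colP => -[[|[|[|//]]]] k; rewrite !mxE.
- apply: ler_sum => a _; apply: ler_sum => b _ /=.
  apply: (line (pt3 (node N a) (node N b) 0) (fun t => pt3 (node N a) (node N b) t)) => t.
  by apply/colP => -[[|[|[|//]]]] k; rewrite !mxE.
Qed.

(** The nodes are equally spaced, so the indices in [S] all lie in a run of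
    consecutive integers whose length is governed by [L]. *)
Lemma count_nodes N (S : pred 'I_N) (L : R) : (0 < N)%N -> 0 <= L ->
  (forall a b : 'I_N, S a -> S b -> `|node N a - node N b| <= L) ->
  \sum_(a < N) (S a)%:R <= L * N%:R / (2 * M) + 1.
Proof.
move=> N0 L0 SL; have N0' : 0 < N%:R :> R by rewrite ltr0n.
have [a0 Sa0|S0] := pickP S; last first.
  rewrite big1 => [|a _]; last by rewrite S0.
  by rewrite addr_ge0// divr_ge0 ?mulr_ge0// ltW.
pose a1 := [arg min_(a < a0 | S a) (a : nat)]; pose a2 := [arg max_(a > a0 | S a) (a : nat)].
have [Sa1 a1P] : S a1 /\ forall a, S a -> (a1 <= a)%N.
  by rewrite /a1; case: arg_minnP.
have [Sa2 a2P] : S a2 /\ forall a, S a -> (a <= a2)%N.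
  by rewrite /a2; case: arg_maxnP.
have card : (#|S| <= a2 - a1 + 1)%N.
  rewrite cardE -(size_map val) -(size_iota a1 (a2 - a1 + 1)).
  apply: uniq_leq_size; first by rewrite map_inj_uniq ?enum_uniq//; exact: val_inj.
  move=> _ /mapP[a /[!mem_enum] Sa ->]; rewrite mem_iota addn1 addnS subnKC ?a1P//.
  by rewrite ltnS a2P.
have -> : \sum_(a < N) (S a)%:R = (#|S|)%:R :> R.
  rewrite -sum1_card natr_sum [RHS]big_mkcond /=; apply: eq_bigr => a _.
  by rewrite [in RHS]/in_mem /=; case: (S a).
have : (#|S|)%:R <= (a2 - a1 + 1)%:R :> R by rewrite ler_nat.
move=> /le_trans; apply; rewrite natrD lerD2r natrB ?a1P//.
have := SL _ _ Sa2 Sa1; rewrite /node => /(le_trans (ler_norm _)).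
rewrite opprD addrACA subrr add0r -mulrBr => h.
rewrite ler_pdivlMr ?mulr_gt0//.
by move: h; rewrite mulrAC ler_pdivrMr// mulrC.
Qed.

(** An upper bound for the limit superior of the means.  Being eventual, such
    bounds add up although the means need not converge. *)
Definition upmean g (c : R) : Prop := \forall N \near \oo, mean N g <= c.

Lemma upmeanS g g' c : (forall x, g x <= g' x) -> upmean g' c -> upmean g c.
Proof.
by move=> gg'; apply: filterS => N; exact/le_trans/mean_le.
Qed.

Lemma upmeanD g g' c c' : upmean g c -> upmean g' c' ->
  upmean (fun x => g x + g' x) (c + c').
Proof.
by apply: filterS2 => N h h'; rewrite meanD lerD.
Qed.

Lemma upmeanZ g c k : 0 <= k -> upmean g c -> upmean (fun x => k * g x) (k * c).
Proof.
by move=> k0; apply: filterS => N h; rewrite meanZ ler_wpM2l.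
Qed.

Lemma upmean0 c : 0 <= c -> upmean (cst 0) c.
Proof.
move=> c0; apply: nearW => N; rewrite /mean big1 ?mulr0// => a _.
by rewrite big1// => b _; rewrite big1.
Qed.

Lemma upmean_sum (I : Type) (l : seq I) (G : I -> vec R -> R) c :
  (forall i, upmean (G i) c) ->
  upmean (fun x => \sum_(i <- l) G i x) (\sum_(i <- l) c).
Proof.
move=> Gc; elim: l => [|i l IH].
  by rewrite big_nil; under eq_fun do rewrite big_nil; exact: upmean0.
by rewrite big_cons; under eq_fun do rewrite big_cons; exact: upmeanD.
Qed.

Lemma near_gt_nat (K : R) : \forall N \near \oo, K < N%:R.
Proof.
exists (Num.truncn K).+1 => // N /= KN; apply: lt_le_trans (_ : (Num.truncn K).+1%:R <= _).
  exact: truncnS_gt.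
by rewrite ler_nat.
Qed.

(** Each line of direction [j] carries at most [L / (2 * M / N) + 1] nodes of
    [T].  The sharp asymptotic bound would be [L / (2 * M)]; the factor 2 absorbs
    the extra node when [N] is large. *)
Lemma upmean_thin (j : 'I_3) (T : set (vec R)) (L : R) : 0 < L ->
  (forall x s t, T (set_coord x j s) -> T (set_coord x j t) -> `|s - t| <= L) ->
  upmean (fun x => (`[< T x >])%:R) (L / M).
Proof.
move=> L0 TL; have := near_gt_nat (2 * M / L); apply: filterS => N NL.
have N0 : 0 < N%:R :> R by apply: lt_trans NL; rewrite divr_gt0 ?mulr_gt0.
apply: le_trans (mean_line (j := j) (B := L * N%:R / (2 * M) + 1) _ _) _.
- by rewrite -(ltr0n R).
- move=> x; pose S : pred 'I_N := fun a => `[< T (set_coord x j (node N a)) >].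
  apply: (@count_nodes N S L) => //; [by rewrite -(ltr0n R)|exact: ltW|].
  by move=> a b /asboolP Ta /asboolP Tb; exact: TL Ta Tb.
- rewrite ler_pdivrMr// -lerBrDl.
  rewrite ltr_pdivrMr// in NL.
  have -> : L / M * N%:R - L * N%:R / (2 * M) = N%:R * L / (2 * M) by field; rewrite gt_eqF.
  by rewrite ler_pdivlMr ?mulr_gt0// mul1r ltW.
Qed.

Lemma sum_box N (f : 'I_3 -> R -> R) :
  \sum_(a < N) \sum_(b < N) \sum_(c < N)
    \prod_i f i (pt3 (node N a) (node N b) (node N c) i 0)
  = \prod_i \sum_(a < N) f i (node N a).
Proof.
rewrite !big_ord_recl big_ord0 mulr1 mulr_suml; apply: eq_bigr => a _.
rewrite mulr_suml mulr_sumr; apply: eq_bigr => b _.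
rewrite !mulr_sumr; apply: eq_bigr => c _.
by rewrite !big_ord_recl big_ord0 mulr1 !mxE /=.
Qed.

Lemma ball_prod (c : vec R) (r : R) x : 0 <= r ->
  (`|x - c| <= r)%R%:R = \prod_i (`|x i 0 - c i 0| <= r)%R%:R :> R.
Proof.
move=> r0; have [xc|] := boolP (`|x - c| <= r).
  rewrite big1// => i _; have := le_trans (vec_coord_le (x - c) i) xc.
  by rewrite !mxE => ->.
move=> xc; have [i xi] : exists i, ~~ (`|x i 0 - c i 0| <= r).
  apply: contrapT => /forallNP h; move/negP: xc; apply.
  by apply: vec_norm_le => // i; rewrite !mxE; move/negP/negPn: (h i).
by rewrite (bigD1 i)//= (negbTE xi) mul0r.
Qed.

(** As in [upmean_thin], a factor 2 in each direction makes up for rounding. *)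
Lemma upmean_ball (c : vec R) (r : R) : 0 < r ->
  upmean (fun x => (`|x - c| <= r)%R%:R) (8 * (r / M) ^+ 3).
Proof.
move=> r0; have := near_gt_nat (M / r); apply: filterS => N NL.
have N0 : 0 < N%:R :> R by apply: lt_trans NL; rewrite divr_gt0.
rewrite /mean; under eq_bigr do under eq_bigr do under eq_bigr do rewrite (ball_prod _ _ (ltW r0)).
rewrite (sum_box N (fun i t => (`|t - c i 0| <= r)%R%:R)) ler_pdivrMl ?exprn_gt0//.
have -> : N%:R ^+ 3 * (8 * (r / M) ^+ 3) = \prod_(i < 3) (2 * (r / M) * N%:R) :> R.
  by rewrite !big_ord_recl big_ord0 mulr1; ring.
apply: ler_prod => i _; apply/andP; split; first by apply: sumr_ge0.
apply: le_trans (count_nodes (S := fun a => `|node N a - c i 0| <= r) (L := 2 * r) _ _ _) _.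
- by rewrite -(ltr0n R).
- by rewrite mulr_ge0// ltW.
- move=> a b; rewrite !ler_norml => /andP[? ?] /andP[? ?]; apply/andP; split; lra.
- rewrite ltr_pdivrMr// in NL.
  have -> : 2 * (r / M) * N%:R = 2 * r * N%:R / (2 * M) + (N%:R * r / M) by field; rewrite gt_eqF.
  by rewrite lerD2l ler_pdivlMr// mul1r ltW.
Qed.

End Grid.

Section GridLimits.
Variables (R : realType) (M : R).
Hypothesis M0 : 0 < M.
Implicit Types (x y : vec R) (g : vec R -> R) (N : nat).

Lemma nodeS N a : node M N a.+1 - node M N a = 2 * M / N%:R.
Proof. by rewrite /node -natr1; ring. Qed.

Lemma node0 N : node M N 0 = - M.
Proof. by rewrite /node mulr0 addr0. Qed.

Lemma nodeN N : (0 < N)%N -> node M N N = M.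
Proof.
move=> N0; have N0' : N%:R != 0 :> R by rewrite pnatr_eq0 -lt0n.
by rewrite /node; field.
Qed.

(** The clipped coordinate rises by [r] in total over the grid, by at most one
    mesh width at each step, and only at nodes within [r] of [c]; telescoping
    thus counts nodes from below. *)
Lemma count_nodes_ge N (c r : R) : (0 < N)%N -> `|c| + r <= M -> 4 * M / r <= N%:R -> 0 < r ->
  r * N%:R / (2 * M) <= \sum_(a < N) (`|node M N a - c| <= r)%R%:R.
Proof.
move=> N0 crM rN r0; have N0' : 0 < N%:R :> R by rewrite ltr0n.
set h := 2 * M / N%:R.
have h0 : 0 < h by rewrite divr_gt0 ?mulr_gt0.
have hr : h <= r / 2.
  rewrite /h ler_pdivrMr// mulrAC ler_pdivlMr//; move: rN; rewrite ler_pdivrMr//.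
  by move=> ?; lra.
have [cM1 cM2] : - M <= c - r /\ c + r <= M.
  by have := ler_norm c; have := ler_norm (- c); rewrite normrN => *; split; lra.
pose clip t : R := Num.max (c - r / 2) (Num.min t (c + r / 2)).
have tel : \sum_(a < N) (clip (node M N a.+1) - clip (node M N a)) = r.
  rewrite -(big_mkord xpredT (fun a => clip (node M N a.+1) - clip (node M N a))).
  rewrite telescope_sumr// node0 nodeN// /clip (@min_l _ _ (- M)); last lra.
  rewrite (@min_r _ _ M); last lra.
  rewrite (@max_r _ _ _ (c + _)); last lra.
  rewrite max_l; last lra.
  by field.
suff : r <= h * \sum_(a < N) (`|node M N a - c| <= r)%R%:R.
  set S := \sum_(a < N) _ => rS; rewrite ler_pdivrMr ?mulr_gt0//.
  have -> : S * (2 * M) = h * S * N%:R by rewrite /h; field; rewrite gt_eqF.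
  by rewrite ler_pM2r.
rewrite -{1}tel mulr_sumr; apply: ler_sum => a _.
have := nodeS N a; rewrite -/h => E; have {E} -> : node M N a.+1 = node M N a + h by lra.
rewrite /clip; case: (lerP `|node M N a - c| r) => [_|].
  rewrite mulr1; set nd := node M N a.
  case: (leP (nd + h) (c + r / 2)) => ?; case: (leP nd (c + r / 2)) => ?;
  case: (leP (c - r / 2) (nd + h)) => ?; case: (leP (c - r / 2) nd) => ?;
  case: (leP (c - r / 2) (c + r / 2)) => ?; lra.
rewrite mulr0 ltr_normr => /orP[?|?].
  by rewrite !min_r ?subrr; lra.
by rewrite !min_l ?max_l ?subrr; lra.
Qed.

Lemma mean_ball_ge (c : vec R) (r : R) : 0 < r -> (forall i, `|c i 0| + r <= M) ->
  \forall N \near \oo, (r / (2 * M)) ^+ 3 <= mean M N (fun x => (`|x - c| <= r)%R%:R).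
Proof.
move=> r0 crM; have := near_gt_nat (4 * M / r); apply: filterS => N NL.
have N0 : 0 < N%:R :> R by apply: lt_trans NL; rewrite divr_gt0 ?mulr_gt0.
rewrite /mean; under eq_bigr do under eq_bigr do under eq_bigr do rewrite (ball_prod _ _ (ltW r0)).
rewrite (sum_box M N (fun i t => (`|t - c i 0| <= r)%R%:R)) ler_pdivlMl ?exprn_gt0//.
have -> : N%:R ^+ 3 * (r / (2 * M)) ^+ 3 = \prod_(i < 3) (r * N%:R / (2 * M)) :> R.
  by rewrite !big_ord_recl big_ord0 mulr1; ring.
apply: ler_prod => i _; apply/andP; split; first by rewrite divr_ge0 ?mulr_ge0 ?(ltW r0) ?(ltW M0).
by apply: count_nodes_ge => //; [rewrite -(ltr0n R)|exact: ltW].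
Qed.

Lemma uniform_continuity g (L : R) : 0 < L -> continuous g ->
  (forall x, L < `|x| -> g x = 0) -> forall e, 0 < e ->
  exists2 d, 0 < d & forall x y, `|x - y| < d -> `|g x - g y| < e.
Proof.
move=> L0 cg gL e e0.
pose K : set (vec R) := [set x | `|x| <= 2 * L].
have cK : compact K.
  apply: bounded_closed_compact_vec.
    by exists (2 * L); split; [exact: num_real|move=> b /ltW Lb x /le_trans; exact].
  rewrite (_ : K = (fun x : vec R => `|x|) @^-1` [set t | t <= 2 * L])//.
  by apply: closed_comp; [move=> x _; exact: norm_continuous|exact: closed_le].
have /compact_near_coveringP/(_ R (0 : R)^'+ (fun d x => forall y, `|x - y| < d -> `|g x - g y| < e)) := cK.
case.
  move=> x _; have /cvgrPdist_lt /(_ (e / 2)) := cg x; rewrite divr_gt0// => /(_ isT).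
  move=> /nbhs_ballP[r /= r0 xr].
  exists (ball x (r / 2), [set d | d < r / 2]) => /=.
    by split; [apply: nbhsx_ballx; rewrite divr_gt0|apply: nbhs_right_lt; rewrite divr_gt0].
  move=> [x' d] /= [xx' dr] y x'y.
  have x1 : ball x r x' by apply: le_ball xx'; lra.
  have x2 : ball x r y.
    rewrite (splitr r); apply: ball_triangle xx' _.
    by rewrite -ball_normE /=; exact: lt_trans x'y dr.
  have := xr _ x1; have := xr _ x2; move=> /= h2 h1.
  rewrite (splitr e) -(subrKA (g x)); apply: le_lt_trans (ler_normD _ _) _.
  by rewrite ltrD// distrC.
move=> d /= d0 dK; exists (Num.min (d / 2) L); first by rewrite lt_min L0 divr_gt0.
move=> x y; rewrite lt_min => /andP[xyd xyL].
have [xK|xK] := leP `|x| (2 * L).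
  apply: (dK (d / 2)) => //; last by rewrite divr_gt0.
  by rewrite /= sub0r normrN ger0_norm; lra.
rewrite !gL ?subrr ?normr0//; last lra.
have := ler_distD 0 x y; have := ler_normB x y; have := lerB_dist x y; lra.
Qed.

(** Discrete form of the vanishing of the integral of a derivative: along the
    lines of the grid the increments telescope. *)
Lemma mean_pd_le g (j : 'I_3) : (forall x, differentiable g x) ->
  continuous (pd j g) -> (forall x, M <= `|x| -> g x = 0) ->
  forall e, 0 < e -> upmean M (pd j g) e.
Proof.
move=> dg cg gM e e0.
have pdM x : M < `|x| -> pd j g x = 0.
  move=> Mx; rewrite (@near_eq_pd _ j g (cst 0)) ?(@pd_cst R)//.
  have /cvgrPdist_lt/(_ (`|x| - M)) := @norm_continuous _ _ x.
  rewrite subr_gt0 => /(_ Mx); apply: filterS => y h; apply: gM.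
  by move: h; rewrite ltr_norml => /andP[_]; lra.
have [d d0 ud] := uniform_continuity M0 cg pdM e0.
have := near_gt_nat (2 * M / d); apply: filterS => N NL.
have N0 : 0 < N%:R :> R by apply: lt_trans NL; rewrite divr_gt0 ?mulr_gt0.
have N0n : (0 < N)%N by rewrite -(ltr0n R).
have hd : 2 * M / N%:R < d by move: NL; rewrite !ltr_pdivrMr// => ?; lra.
have h0 : 0 < 2 * M / N%:R by rewrite divr_gt0 ?mulr_gt0.
rewrite -[e](mulfK (lt0r_neq0 N0)).
apply: (@mean_line R M N (pd j g) j _ N0n) => x.
have tel : \sum_(a < N) (g (set_coord x j (node M N a.+1)) - g (set_coord x j (node M N a))) = 0.
  rewrite -(big_mkord xpredT (fun a => g (set_coord x j (node M N a.+1)) - g (set_coord x j (node M N a)))).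
  rewrite telescope_sumr// node0 nodeN// !gM ?subrr//.
    by apply: le_trans (vec_coord_le _ j); rewrite mxE eqxx normrN ler_norm.
  by apply: le_trans (vec_coord_le _ j); rewrite mxE eqxx ler_norm.
rewrite -(ler_pM2l h0) -[leLHS]subr0 -[X in _ - X]tel mulr_sumr -sumrB.
have -> : 2 * M / N%:R * (e * N%:R) = \sum_(a < N) (2 * M / N%:R * e).
  by rewrite sumr_const card_ord -[RHS]mulr_natr -[RHS]mulrA.
apply: ler_sum => a _.
have lt_node : node M N a < node M N a.+1 by rewrite -subr_gt0 nodeS.
have [z /andP[za zb] ->] := set_coord_MVT lt_node (fun z _ => dg (set_coord x j z)).
rewrite nodeS [_ * (2 * M / _)]mulrC -mulrBr ler_pM2l//.
apply: le_trans (ler_norm _) (ltW (ud _ _ _)).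
rewrite vec_norm_lt//; apply/forallP => i; rewrite !mxE; case: eqP => _; last by rewrite subrr normr0.
by rewrite ltr_norml; have := nodeS N a; lra.
Qed.

End GridLimits.

(** * Cutoffs near the boundary and their cost *)

Section CompactInduction.
Variable R : realType.

Lemma compact_induction (K : set (vec R)) (P : set (vec R) -> Prop) :
  compact K -> P set0 -> (forall A B, P A -> P B -> P (A `|` B)) ->
  (forall A B, A `<=` B -> P B -> P A) ->
  (forall x, K x -> exists2 V, nbhs x V & P V) -> P K.
Proof.
move=> cK P0 PU PS loc.
have /boolp.choice[f fP] : forall x, exists V : set (vec R), K x -> [/\ open V, V x & P V].
  move=> x; have [/loc[V xV PV]|nK] := pselect (K x); last by exists set0.
  exists V^° => _; split; [exact: open_interior|exact: xV|].
  by apply: PS PV; exact: interior_subset.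
move: cK; rewrite compact_cover => /(_ _ K f).
case; first by move=> x /fP[].
  by move=> x Kx; exists x => //; have [] := fP x Kx.
move=> D DK Kcov; apply: PS Kcov _; rewrite /cover bigcup_fset.
suff : forall l : seq (vec R), {subset l <= K} -> P (\big[setU/set0]_(x <- l) f x).
  by move=> h; apply: h => x xD; exact: DK.
elim=> [|x l IH] lK; first by rewrite big_nil.
rewrite big_cons; apply: PU; last by apply: IH => y yl; apply: lK; rewrite inE yl orbT.
by have [] := fP x; first by rewrite -[K x]inE; apply: lK; rewrite inE eqxx.
Qed.

End CompactInduction.

Section Barriers.
Variables (R : realType) (M : R) (Omega : set (vec R)) (F : 'I_3 -> vec R -> R).
Variables (B d0 : R) (P0 : set (vec R)).
Hypotheses (M0 : 0 < M) (B0 : 0 < B) (d00 : 0 < d0).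
Hypothesis oO : open Omega.
Hypothesis FB : forall j x, Omega x -> `|F j x| <= B.
Hypothesis P0far : forall x z, P0 x -> boundary Omega z -> d0 <= `|x - z|.
Implicit Types (x y z : vec R) (V W : set (vec R)) (chi : vec R -> R).

(** The integrand of the cost of a cutoff: in [Omega], the absolute difference
    between [div (chi F)] and [chi div F]. *)
Definition flux chi x : R :=
  if `[< Omega x >] then `|\sum_j F j x * pd j chi x| else 0.

(** The set [P0] is the place at which the divergence is to be tested. *)
Definition barrier V (c : R) : Prop := exists chi,
  [/\ C1_on Omega chi, forall x, Omega x -> 0 <= chi x <= 1,
      forall x, P0 x -> chi x = 1,
      forall z, V z -> boundary Omega z -> \forall y \near z, Omega y -> chi y = 0 &
      upmean M (flux chi) c].

Lemma barrierS V W c c' : V `<=` W -> c <= c' -> barrier W c -> barrier V c'.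
Proof.
move=> VW cc' [chi [? ? ? h1 h2]]; exists chi; split=> //; first by move=> z /VW; exact: h1.
by apply: filterS h2 => N /le_trans; exact.
Qed.

Lemma barrier_away V c : 0 <= c -> (forall z, V z -> ~ boundary Omega z) -> barrier V c.
Proof.
move=> c0 Vb; exists (cst 1); split=> //; first exact: C1_on_cst.
- by move=> x _; rewrite /= ler01 lexx.
- by move=> z /Vb.
- apply: upmeanS (upmean0 M c0) => x; rewrite /flux; case: ifP => // _.
  by rewrite big1 ?normr0// => j _; rewrite (@pd_cst R) mulr0.
Qed.

(** Cutoffs are multiplied; by the product rule their costs add up. *)
Lemma barrierU V W c c' : barrier V c -> barrier W c' -> barrier (V `|` W) (c + c').
Proof.
move=> [f [fC f01 fP fV fc]] [g [gC g01 gP gW gc]].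
exists (fun x => f x * g x); split.
- exact: C1_onM.
- move=> x Ox; have /andP[? ?] := f01 x Ox; have /andP[? ?] := g01 x Ox.
  by rewrite mulr_ge0//= mulr_ile1.
- by move=> x Px; rewrite fP// gP// mulr1.
- move=> z [Vz|Wz] bz; [have := fV z Vz bz|have := gW z Wz bz];
    by apply: filterS => y h /h ->; rewrite ?mul0r ?mulr0.
- apply: upmeanS (upmeanD fc gc) => x; rewrite /flux.
  case: asboolP => [Ox|_]; last by rewrite addr0.
  have /andP[f0 f1] := f01 x Ox; have /andP[g0 g1] := g01 x Ox.
  have [df _] := fC x Ox; have [dg _] := gC x Ox.
  have -> : \sum_j F j x * pd j (fun y => f y * g y) x =
      g x * (\sum_j F j x * pd j f x) + f x * (\sum_j F j x * pd j g x).
    rewrite !mulr_sumr -big_split /=; apply: eq_bigr => j _.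
    by rewrite pdM//; ring.
  apply: le_trans (ler_normD _ _) _; rewrite !normrM (ger0_norm f0) (ger0_norm g0).
  by apply: lerD; exact: ler_piMl.
Qed.

Lemma flux_bound chi x b : Omega x -> (forall j, `|pd j chi x| <= b) ->
  `|\sum_j F j x * pd j chi x| <= 3 * B * b.
Proof.
move=> Ox hb; apply: le_trans (ler_norm_sum _ _ _) _.
rewrite (_ : 3 * B * b = \sum_(j < 3) (B * b)); last first.
  by rewrite sumr_const card_ord -[RHS]mulr_natl mulrA.
by apply: ler_sum => j _; rewrite normrM; apply: ler_pM => //; exact: FB.
Qed.

(** The cutoff has slope of order [1 / r] on a volume of order [r ^+ 3], hence a
    cost of the order of the area of the sphere. *)
Lemma barrier_ball c r : 0 < r -> 3 * r <= d0 ->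
  barrier (ball c r) (24 * 64 * B / M ^+ 3 * r ^+ 2).
Proof.
move=> r0 rd; have [[z [bz cz]]|nz] := pselect (exists z, boundary Omega z /\ ball c r z); last first.
  apply: barrier_away; last by move=> z cz bz; apply: nz; exists z.
  by rewrite mulr_ge0 ?sqr_ge0// divr_ge0 ?exprn_ge0 ?mulr_ge0 ?ler0n// ltW.
have [psi [psiC psi01 psi1 psi0 dpsi]] := bump_exists c r0.
have pdE j x : pd j (fun y => 1 - psi y) x = - pd j psi x.
  rewrite (@pdB R j (cst 1)) ?(@pd_cst R) ?sub0r//.
  by have [] := psiC x I.
exists (fun x => 1 - psi x); split.
- by apply: C1_onB => //; [exact: C1_on_cst|exact: C1_on_sub psiC].
- by move=> x _; have := psi01 x; lra.
- move=> x Px; rewrite psi0 ?subr0// leNgt; apply/negP => xc.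
  have := P0far Px bz; apply/negP; rewrite -ltNge.
  apply: le_lt_trans (ler_distD c x z) _.
  by move: cz; rewrite -ball_normE /= => cz; lra.
- move=> y cy _; near=> w => _; rewrite psi1 ?subrr// distrC ltW//.
  have : ball c r w by near: w; apply: open_nbhs_nbhs; split=> //; exact: ball_open.
  by rewrite -ball_normE.
- have r20 : 0 < 2 * r by rewrite mulr_gt0.
  have := upmeanZ (k := 3 * B * (8 / r)) _ (upmean_ball M0 c r20).
  rewrite (_ : 3 * B * (8 / r) * (8 * (2 * r / M) ^+ 3) = 24 * 64 * B / M ^+ 3 * r ^+ 2); last first.
    by field; rewrite !gt_eqF.
  have B8 : 0 <= 3 * B * (8 / r) by rewrite mulr_ge0 ?divr_ge0 ?mulr_ge0// ltW.
  move=> h; apply: upmeanS (h B8) => x.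
  rewrite /flux; case: asboolP => [Ox|_]; last by rewrite mulr_ge0.
  have [xc|xc] := leP `|x - c| (2 * r).
    by rewrite mulr1; apply: flux_bound => // j; rewrite pdE normrN.
  rewrite mulr0 big1 ?normr0// => j _; rewrite (@near_eq_pd _ j _ (cst 1)) ?(@pd_cst R) ?mulr0//.
  by near=> y; rewrite psi0 ?subr0// ltW//; near: y; apply: open_nbhs_nbhs; split=> //; exact: open_far.
Unshelve. all: by end_near. Qed.

Lemma barrier_balls (c : nat -> vec R) (r : nat -> R) N :
  (forall k, 0 < r k) -> (forall k, 3 * r k <= d0) ->
  barrier (\bigcup_(k in `I_N) ball (c k) (r k)) (24 * 64 * B / M ^+ 3 * \sum_(k < N) r k ^+ 2).
Proof.
move=> r0 rd; elim: N => [|N IH].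
  rewrite II0 bigcup_set0 big_ord0 mulr0; exact: barrier_away.
rewrite big_ord_recr /= mulrDr; apply: barrierS (barrierU IH (barrier_ball (c N) (r0 N) (rd N))) => //.
move=> x [k /= kN xk]; move: kN; rewrite ltnS leq_eqVlt => /orP[/eqP <-|kN]; first by right.
by left; exists k.
Qed.

End Barriers.

Section RegularBarriers.
Variables (R : realType) (M : R) (Omega : set (vec R)) (F : 'I_3 -> vec R -> R).
Variables (B d0 : R) (P0 : set (vec R)).
Hypotheses (M0 : 0 < M) (B0 : 0 < B) (d00 : 0 < d0).
Hypothesis oO : open Omega.
Hypothesis FB : forall j x, Omega x -> `|F j x| <= B.
Hypothesis P0far : forall x z, P0 x -> boundary Omega z -> d0 <= `|x - z|.
Implicit Types (x y z : vec R) (V W : set (vec R)) (chi rho : vec R -> R).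

Hypothesis no_flux : forall (U : set (vec R)) rho z, open U -> C1_on U rho ->
  (forall y, U y -> (Omega y <-> rho y < 0)) -> U z -> rho z = 0 ->
  sgrad rho z != 0 ->
  (\sum_j F j y * pd j rho y) @[y --> within Omega (nbhs z)] --> (0 : R).

Lemma compact_closed_ball_vec x (r : R) : compact [set y : vec R | `|y - x| <= r].
Proof.
apply: bounded_closed_compact_vec.
  exists (r + `|x|); split; first exact: num_real.
  move=> b rb y /= yx; rewrite -(subrK x y); apply: le_trans (ler_normD _ _) _.
  by rewrite (le_trans _ (ltW rb))// lerD2r.
rewrite (_ : [set y | _] = (fun y : vec R => `|y - x|) @^-1` [set t | t <= r])//.
apply: closed_comp; last exact: closed_le.
move=> y _; apply: continuous_comp; last exact: norm_continuous.
by apply: continuousB => //; exact: cst_continuous.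
Qed.

(** Compactness turns the vanishing of the flux through the boundary piece of a
    chart into its smallness in a thin layer. *)
Lemma flux_small (U : set (vec R)) rho x (r k : R) :
  open U -> C1_on U rho -> (forall y, U y -> (Omega y <-> rho y < 0)) ->
  (forall y, `|y - x| <= r -> U y /\ sgrad rho y != 0) -> 0 < k ->
  exists2 d, 0 < d & forall y, `|y - x| <= r -> Omega y -> - d <= rho y ->
    `|\sum_j F j y * pd j rho y| <= k.
Proof.
move=> oU rhoC rhoO rU k0.
have /compact_near_coveringP cK := compact_closed_ball_vec (x := x) (r := r).
have [] := cK R (0 : R)^'+ (fun d y => Omega y -> - d <= rho y -> `|\sum_j F j y * pd j rho y| <= k).
  move=> z /rU[Uz gz].
  have crho : {for z, continuous rho} := C1_on_continuous rhoC Uz.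
  have nU : \forall y \near z, U y by exact: open_nbhs_nbhs.
  have [rz|rz|rz] := ltgtP (rho z) 0.
  - have nr : \forall y \near z, rho y < rho z / 2.
      by apply: (cvgr_lt (rho z) crho); lra.
    exists ([set y | rho y < rho z / 2], [set d | d < - (rho z / 2)]) => /=.
      by split=> //; apply: nbhs_right_lt; lra.
    by move=> [y d] /= [h1 h2] _ h3; exfalso; lra.
  - have nr : \forall y \near z, 0 < rho y by apply: (cvgr_gt (rho z) crho).
    exists ([set y | 0 < rho y /\ U y], setT) => /=.
      by split; [exact: filterI|exact: filterT].
    by move=> [y d] /= [[h1 Uy] _] /(rhoO _ Uy) h2; exfalso; lra.
  - have /cvgrPdist_le/(_ _ k0) := no_flux oU rhoC rhoO Uz rz gz.
    rewrite near_withinE => nq.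
    exists ([set y | Omega y -> `|0 - \sum_j F j y * pd j rho y| <= k], setT) => /=.
      by split; [exact: nq|exact: filterT].
    by move=> [y d] /= [h _] /h; rewrite sub0r normrN.
move=> d /= d0' dK; exists (d / 2); first by rewrite divr_gt0.
move=> y yr Oy rd; apply: (dK (d / 2)) => //; last by rewrite divr_gt0.
by rewrite /= sub0r normrN ger0_norm; lra.
Qed.

(** Near a regular boundary point a cutoff varying only across the layer
    [- 2 e <= rho < 0] has slope of order [1 / e] on a volume of order [e];
    the slope being normal to the boundary, only the flux enters, which is
    small. *)
Lemma barrier_regular x : boundary Omega x -> regular_boundary Omega x ->
  exists2 V, nbhs x V & forall c, 0 < c -> barrier M Omega F P0 V c.
Proof.
move=> bx [v [U [rho [[oU Ux rhoC] [rhoO rx gx _]]]]].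
have [j gj] : exists j, pd j rho x != 0.
  apply: contrapT => /forallNP h; move/negP: gx; apply; apply/eqP/colP => j.
  by rewrite !mxE; apply/eqP; move: (h j) => /negP/negPn.
pose m := `|pd j rho x| / 2.
have m0 : 0 < m by rewrite divr_gt0// normr_gt0.
have nm : \forall y \near x, m < `|pd j rho y|.
  have [_ /(_ j) cj] := rhoC x Ux.
  have /cvgrPdist_lt/(_ m m0) := cj; apply: filterS => y h.
  have := lerB_dist (pd j rho x) (pd j rho y); move: h; rewrite /m; lra.
clearbody m.
have /nbhs_ballP[r' /= r'0 r'P] : \forall y \near x, U y /\ m < `|pd j rho y|.
  by apply: filterI nm; exact: open_nbhs_nbhs.
pose s := Num.min (r' / 3) (d0 / 2).
have s0 : 0 < s by rewrite lt_min !divr_gt0.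
have [sr sd] : 3 * s <= r' /\ 2 * s <= d0.
  have : s <= r' / 3 by rewrite ge_min lexx.
  have : s <= d0 / 2 by rewrite ge_min lexx orbT.
  by lra.
clearbody s.
have inU y : `|y - x| <= 2 * s -> U y /\ m < `|pd j rho y|.
  by move=> yx; apply: r'P; rewrite -ball_normE /= distrC; lra.
exists (ball x s); first exact: nbhsx_ballx.
move=> c c0.
(* The flux through the layer and the lateral variation of the bump each
   contribute at most [c / 2] for this choice of [k] and [e]. *)
pose k := c * m * M / 32.
have k0 : 0 < k.
  apply: divr_gt0; last by rewrite ltr0n.
  by do ?apply: mulr_gt0.
have inU' y : `|y - x| <= 2 * s -> U y /\ sgrad rho y != 0.
  move=> /inU[Uy my]; split=> //; apply/eqP => /colP/(_ j); rewrite !mxE => pd0.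
  by move: my; rewrite pd0 normr0; lra.
have [d d0' dP] := flux_small oU rhoC rhoO inU' k0.
pose e := Num.min (d / 2) (c * s * m * M / (192 * B)).
have csmM : 0 < c * s * m * M by do ?apply: mulr_gt0.
have e0 : 0 < e by rewrite lt_min !divr_gt0// mulr_gt0 ?ltr0n.
have [ed ec] : 2 * e <= d /\ e * (192 * B) <= c * s * m * M.
  have : e <= d / 2 by rewrite ge_min lexx.
  have : e <= c * s * m * M / (192 * B) by rewrite ge_min lexx orbT.
  by rewrite ler_pdivlMr ?mulr_gt0// => ? ?; split=> //; lra.
clearbody e.
have [psi [psiC psi01 psi1 psi0 dpsi]] := bump_exists x s0.
pose w y := step (- e^-1 * rho y).
pose chi y := if `[< U y >] then 1 - psi y * w y else 1.
have chiU y : U y -> chi y = 1 - psi y * w y by rewrite /chi; case: asboolP.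
have chi_far y : 2 * s <= `|y - x| -> chi y = 1.
  by rewrite /chi; case: asboolP => // _ ys; rewrite psi0// mul0r subr0.
have wC : C1_on U w.
  apply: (@C1_on_comp R U (@step R) (fun y => - e^-1 * rho y)) => //.
  - by apply: C1_onM => //; exact: C1_on_cst.
  - exact: derivable_step.
  - exact: continuous_derive1_step.
have psiCU : C1_on U psi by exact: C1_on_sub psiC.
have w01 y : 0 <= w y <= 1 by exact: step01.
have chiC : C1_on U (fun y => 1 - psi y * w y).
  by apply: C1_onB => //; [exact: C1_on_cst|exact: C1_onM].
have pdw i y : U y -> pd i w y = derive1 (@step R) (- e^-1 * rho y) * (- e^-1 * pd i rho y).
  move=> Uy; have [dr _] := rhoC y Uy.
  have dcr : differentiable (fun y => - e^-1 * rho y) y by exact: differentiableM.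
  rewrite /w (@pd_comp R i (@step R) (fun y => - e^-1 * rho y))//; last exact: derivable_step.
  by rewrite (@pdM R i (cst (- e^-1)))// (@pd_cst R) mulr0 addr0.
have pdchi i y : U y -> pd i chi y = - (psi y * pd i w y + w y * pd i psi y).
  move=> Uy; have [dw _] := wC y Uy; have [dp _] := psiCU y Uy.
  rewrite (@near_eq_pd R i chi (fun y => 1 - psi y * w y)); last first.
    by near=> z; apply: chiU; near: z; exact: open_nbhs_nbhs.
  rewrite (@pdB R i (cst 1))//; last exact: differentiableM.
  by rewrite (@pd_cst R) sub0r pdM.
(* The layer to which the variation of the cutoff is confined. *)
pose T := [set y | [/\ `|y - x| <= 2 * s, U y & `|rho y| <= 2 * e]].
have thin : upmean M (fun y => (`[< T y >])%:R) (4 * e / m / M).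
  apply: (@upmean_thin R M M0 j) => [|y a b]; first by rewrite divr_gt0// mulr_gt0.
  wlog ab : a b / a < b.
    move=> h; have [ab|ab|->] := ltgtP a b; first exact: h.
      by move=> ? ?; rewrite distrC; exact: h.
    by rewrite subrr normr0 divr_ge0 ?mulr_ge0 ?(ltW e0) ?(ltW m0).
  move=> [ax Ua ra] [bx' Ub rb].
  have seg (z : R) : a <= z <= b -> `|set_coord y j z - x| <= 2 * s.
    move=> /andP[az zb]; apply: vec_norm_le => [|i]; first by rewrite mulr_ge0// ltW.
    have := le_trans (vec_coord_le _ i) ax; have := le_trans (vec_coord_le _ i) bx'.
    rewrite !mxE; case: eqP => // _; rewrite !ler_norml => /andP[? ?] /andP[? ?].
    by apply/andP; split; lra.
  have [z|z /andP[za zb] E] := @set_coord_MVT R rho y j a b ab.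
    by move=> /seg/inU[Uz _]; have [] := rhoC _ Uz.
  have [|_ mz] := inU (set_coord y j z); first by apply: seg; rewrite !ltW.
  rewrite distrC ler_pdivlMr//.
  have : `|rho (set_coord y j b) - rho (set_coord y j a)| <= 4 * e.
    by apply: le_trans (ler_normB _ _) _; lra.
  rewrite E normrM mulrC; apply: le_trans.
  by rewrite ler_wpM2l// ltW.
exists chi; split.
- apply: C1_on_local => y Oy.
  have [ys|ys] := leP `|y - x| (2 * s).
    by have [Uy _] := inU y ys; exists U, (fun y => 1 - psi y * w y).
  exists [set y | 2 * s < `|y - x|], (cst 1); split=> //.
  + exact: open_far.
  + exact: C1_on_cst.
  + by move=> z /= /ltW; exact: chi_far.
- move=> y Oy; rewrite /chi; case: asboolP => [Uy|_]; last by rewrite ler01 lexx.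
  have /andP[? ?] := w01 y; have /andP[? ?] := psi01 y.
  by rewrite subr_ge0 mulr_ile1//= gerBl mulr_ge0.
- move=> y Py; apply: chi_far; apply: le_trans sd _; exact: P0far.
- move=> z; rewrite -ball_normE /= distrC => zs bz.
  have [Uz _] : U z /\ m < `|pd j rho z| by apply: inU; lra.
  have rz : - e < rho z.
    rewrite (lt_le_trans (y := 0)) ?oppr_lt0// leNgt; apply/negP => rz.
    by case: bz => _; apply; apply/rhoO.
  near=> y => Oy.
  rewrite chiU; last by near: y; exact: open_nbhs_nbhs.
  rewrite psi1; last first.
    have : ball x s y.
      near: y; apply: open_nbhs_nbhs; split; first exact: ball_open.
      by rewrite -ball_normE /= distrC.
    by rewrite -ball_normE /= distrC => /ltW.
  rewrite /w step_le1 ?mulr1 ?subrr// mulNr -mulrN mulrC ler_pdivrMr// mul1r lerNl ltW//.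
  by near: y; exact: (cvgr_gt (rho z) (C1_on_continuous rhoC Uz)).
- have K0 : 0 <= 4 * k / e + 3 * B * (8 / s).
    by apply/ltW/addr_gt0; [apply: divr_gt0|apply: mulr_gt0; last apply: divr_gt0] => //; rewrite mulr_gt0 ?ltr0n.
  have := upmeanZ K0 thin; set Q := (X in upmean _ _ X -> _) => h.
  have {}h : upmean M (fun y => (4 * k / e + 3 * B * (8 / s)) * (`[< T y >])%:R) c.
    apply: filterS h => N /le_trans; apply.
    have -> : Q = c / 2 + e * (96 * B) / (s * m * M).
      by rewrite /Q /k; field; rewrite !gt_eqF.
    have : e * (96 * B) / (s * m * M) <= c / 2.
      rewrite ler_pdivrMr; last by do ?apply: mulr_gt0.
      by move: ec; lra.
    by lra.
  apply: upmeanS h => y; rewrite /flux; case: asboolP => [Oy|_]; last by rewrite mulr_ge0.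
  have far (V : set (vec R)) : open V -> V y -> (forall z, V z -> chi z = 1) ->
      `|\sum_j F j y * pd j chi y| <= (4 * k / e + 3 * B * (8 / s)) * (`[< T y >])%:R.
    move=> oV Vy V1; rewrite big1 ?normr0 ?mulr_ge0// => i _.
    rewrite (@near_eq_pd R i chi (cst 1)) ?(@pd_cst R) ?mulr0//.
    by near=> z; apply: V1; near: z; exact: open_nbhs_nbhs.
  have [ys|ys] := leP `|y - x| (2 * s); last first.
    by apply: (far _ (@open_far R x (2 * s)) ys) => z /= /ltW; exact: chi_far.
  have [Uy _] := inU y ys; have ry0 : rho y < 0 by apply/rhoO.
  have [ry|ry] := ltP (rho y) (- (2 * e)).
    have oV : open (U `&` rho @^-1` [set t | t < - (2 * e)]).
      rewrite openE => z [Uz rz]; apply: filterI; first exact: open_nbhs_nbhs.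
      exact: (cvgr_lt (rho z) (C1_on_continuous rhoC Uz)).
    apply: (far _ oV) => // z [Uz /= rz].
    rewrite chiU// /w step_ge2 ?mulr0 ?subr0//.
    by rewrite mulNr -mulrN mulrC ler_pdivlMr//; lra.
  have -> : `[< T y >] by apply/asboolP; split=> //; rewrite ltr0_norm//; lra.
  rewrite mulr1.
  pose a := derive1 (@step R) (- e^-1 * rho y).
  have -> : \sum_j F j y * pd j chi y =
      psi y * a * e^-1 * (\sum_j F j y * pd j rho y) - w y * \sum_j F j y * pd j psi y.
    rewrite !mulr_sumr -sumrB; apply: eq_bigr => i _.
    by rewrite pdchi// pdw// -/a; ring.
  apply: le_trans (ler_normB _ _) _; apply: lerD.
    rewrite !normrM normfV (ger0_norm (ltW e0)).
    have /andP[p0 p1] := psi01 y; rewrite (ger0_norm p0).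
    have a4 : `|a| <= 4 by exact: derive1_step_bound.
    have -> : 4 * k / e = 1 * 4 * e^-1 * k by ring.
    have ie : 0 <= e^-1 by rewrite invr_ge0 ltW.
    by apply: ler_pM; rewrite ?mulr_ge0//; [apply: ler_pM; rewrite ?mulr_ge0//; exact: ler_pM|apply: dP => //; lra].
  have /andP[w0 w1] := w01 y.
  rewrite normrM (ger0_norm w0); apply: le_trans (ler_piMl _ w1) _ => //.
  exact: (flux_bound FB Oy).
Unshelve. all: by end_near. Qed.

End RegularBarriers.

(** * A divergence theorem without surface integrals *)

Section Divergence.
Variables (R : realType) (Omega : set (vec R)) (F : 'I_3 -> vec R -> R) (B : R).
Hypothesis bO : body Omega.
Hypothesis B0 : 0 < B.
Hypothesis FC : forall j, C1_on Omega (F j).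
Hypothesis FB : forall j x, Omega x -> `|F j x| <= B.
Implicit Types (x y z : vec R) (V W : set (vec R)) (chi rho : vec R -> R).
Hypothesis no_flux : forall (U : set (vec R)) rho z, open U -> C1_on U rho ->
  (forall y, U y -> (Omega y <-> rho y < 0)) -> U z -> rho z = 0 ->
  sgrad rho z != 0 ->
  (\sum_j F j y * pd j rho y) @[y --> within Omega (nbhs z)] --> (0 : R).

Lemma body_bound : exists2 M, 0 < M & forall x, closure Omega x -> `|x| < M.
Proof.
have [_ _ [M1 [_ OM]] _] := bO.
exists (`|M1| + 2) => [|x Ox]; first by rewrite ltr_wpDl.
have OM1 : Omega `<=` [set y : vec R | `|y| <= `|M1| + 1].
  by move=> y Oy; apply: OM Oy; have := ler_norm M1; lra.
have cl : closed [set y : vec R | `|y| <= `|M1| + 1].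
  rewrite (_ : [set y | _] = (fun y : vec R => `|y|) @^-1` [set t | t <= `|M1| + 1])//.
  by apply: closed_comp; [move=> y _; exact: norm_continuous|exact: closed_le].
have : `|x| <= `|M1| + 1 by have := closure_subset OM1 Ox; rewrite -(closure_id _).1.
lra.
Qed.

Lemma compact_boundary : compact (boundary Omega).
Proof.
have [M M0 OM] := body_bound; have [oO _ _ _] := bO.
apply: bounded_closed_compact_vec.
  by exists M; split; [exact: num_real|move=> b Mb x [/OM xM _]; exact/ltW/(lt_trans xM)].
by rewrite /boundary setDE; apply: closedI; [exact: closed_closure|exact: open_closedC].
Qed.

(** By compactness finitely many charts, each cut off at any prescribed cost, and
    finitely many balls of small total area suffice. *)
Lemma barrier_boundary M d0 (P0 : set (vec R)) : 0 < M -> 0 < d0 ->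
  (forall x z, P0 x -> boundary Omega z -> d0 <= `|x - z|) ->
  forall d, 0 < d -> barrier M Omega F P0 (boundary Omega) d.
Proof.
move=> M0 d00 P0far d dpos; have [oO _ _ null] := bO.
pose Cb := 24 * 64 * B / M ^+ 3.
have Cb0 : 0 < Cb.
  by apply: divr_gt0; rewrite ?exprn_gt0// mulr_gt0// mulr_gt0 ?ltr0n.
pose eps := Num.min ((d0 / 3) ^+ 2) (d / 2 / Cb).
have eps0 : 0 < eps.
  by rewrite lt_min; apply/andP; split; [apply: exprn_gt0|apply: divr_gt0 Cb0]; apply: divr_gt0.
have [e1 e2] : eps <= (d0 / 3) ^+ 2 /\ Cb * eps <= d / 2.
  split; first by rewrite ge_min lexx.
  by rewrite mulrC -ler_pdivlMr// ge_min lexx orbT.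
have [c [r [r0 cov sum_r]]] := null eps eps0.
have rd k : 3 * r k <= d0.
  suff : r k <= d0 / 3 by lra.
  rewrite -(@ler_pXn2r _ 2) ?nnegrE ?divr_ge0 ?(ltW (r0 k)) ?(ltW d00)//.
  apply: le_trans e1.
  apply: le_trans (sum_r k.+1); rewrite big_ord_recr /= lerDr.
  by apply: sumr_ge0 => i _; exact: sqr_ge0.
pose P V := exists N W, (forall h, 0 < h -> barrier M Omega F P0 W h) /\
  V `<=` W `|` \bigcup_(k in `I_N) ball (c k) (r k).
have free0 h : 0 < h -> barrier M Omega F P0 set0 h.
  by move=> h0; apply: barrier_away => //; exact: ltW.
have [N [W [freeW bW]]] : P (boundary Omega).
  apply: (compact_induction compact_boundary).
  - by exists 0%N, set0; split.
  - move=> V V' [N [W [fW VW]]] [N' [W' [fW' VW']]].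
    exists (maxn N N'), (W `|` W'); split.
      move=> h h0; rewrite (splitr h); apply: barrierU => //.
        by apply: fW; rewrite divr_gt0.
      by apply: fW'; rewrite divr_gt0.
    move=> x [/VW[Wx|[k kN xk]]|/VW'[Wx|[k kN xk]]].
    + by left; left.
    + by right; exists k => //=; rewrite leq_max kN.
    + by left; right.
    + by right; exists k => //=; rewrite leq_max kN orbT.
  - by move=> V V' VV' [N [W [fW VW]]]; exists N, W; split=> // x /VV'/VW.
  move=> x bx; have [rx|nrx] := pselect (regular_boundary Omega x).
    have [V xV fV] := barrier_regular M0 B0 d00 FB P0far no_flux bx rx.
    by exists V => //; exists 0%N, V; split=> // y Vy; left.
  have [k _ xk] := cov x (conj bx nrx).
  exists (ball (c k) (r k)); first by apply: open_nbhs_nbhs; split=> //; exact: ball_open.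
  by exists k.+1, set0; split=> // y yk; right; exists k => /=.
have d20 : 0 < d / 2 by rewrite divr_gt0.
have bb := barrierU oO (freeW _ d20) (barrier_balls M0 B0 oO FB P0far c N r0 rd).
apply: (barrierS bW _ bb).
rewrite [leRHS](splitr d) lerD2l -/Cb; apply: le_trans e2.
by rewrite ler_pM2l.
Qed.

(** If the divergence were at least [D > 0] on a ball [P0], the mean of
    [chi div F] would be at least a fixed multiple of [D], while the telescoping
    means and the cost are arbitrarily small. *)
Lemma divergence_vanishes :
  (forall x, Omega x -> 0 <= \sum_j pd j (F j) x) ->
  forall x, Omega x -> \sum_j pd j (F j) x = 0.
Proof.
move=> div0 x0 Ox0; apply/eqP; rewrite eq_le div0// andbT leNgt; apply/negP => D0.
have [oO _ _ _] := bO; have [M M0 OM] := body_bound.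
pose D := (\sum_j pd j (F j) x0) / 2.
have Dpos : 0 < D by rewrite divr_gt0.
have nearD : \forall y \near x0, Omega y /\ D < \sum_j pd j (F j) y.
  apply: filterI; first exact: open_nbhs_nbhs.
  have cd : {for x0, continuous (fun y => \sum_j pd j (F j) y)}.
    apply: (@cvg_finite_sum R _ _ (nbhs x0)) => j; have [_ /(_ j)] := FC j Ox0; exact.
  by apply: (cvgr_gt _ cd); rewrite /D; lra.
have {nearD}/nbhs_ballP[s /= s0 sP] := nearD.
have x0M : `|x0| < M by apply/OM/subset_closure.
pose r := Num.min (s / 2) (M - `|x0|).
have r0 : 0 < r by rewrite lt_min divr_gt0//= subr_gt0.
have [rs rM] : r <= s / 2 /\ r <= M - `|x0|.
  by split; rewrite ge_min lexx ?orbT.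
clearbody r.
pose P0 := [set x : vec R | `|x - x0| <= r].
have P0O x : P0 x -> Omega x /\ D < \sum_j pd j (F j) x.
  by move=> xr; apply: sP; rewrite -ball_normE /= distrC; move: xr; rewrite /P0 /=; lra.
have P0far x z : P0 x -> boundary Omega z -> s / 2 <= `|x - z|.
  move=> xr [_ nz]; rewrite leNgt; apply/negP => xz; apply: nz.
  have [|//] := sP z; rewrite -ball_normE /= distrC.
  apply: le_lt_trans (ler_distD x z x0) _; rewrite [`|z - x|]distrC.
  by move: xr; rewrite /P0 /=; lra.
pose k := (r / (2 * M)) ^+ 3.
have k0 : 0 < k by rewrite exprn_gt0// divr_gt0// mulr_gt0.
(* Three telescoping means and one cost add up to [4 * d], half of the lower
   bound [D * k]. *)
pose d := D * k / 8.
have d0 : 0 < d by apply: divr_gt0; rewrite ?ltr0n// mulr_gt0.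
have s20 : 0 < s / 2 by rewrite divr_gt0.
have [chi [chiC chi01 chi1 chi0 chid]] := barrier_boundary M0 s20 P0far d0.
(* The cut-off field extended by zero is C^1 on the whole space. *)
pose G j x := if `[< Omega x >] then chi x * F j x else 0.
have GO j x : Omega x -> G j x = chi x * F j x by rewrite /G; case: asboolP.
have Gout x : ~ Omega x -> \forall y \near x, forall j, G j y = 0.
  move=> nx; have [cx|ncx] := pselect (closure Omega x).
    have := chi0 x (conj cx nx) (conj cx nx); apply: filterS => y h j.
    by rewrite /G; case: asboolP => // /h ->; rewrite mul0r.
  have : nbhs x (~` closure Omega).
    by apply: open_nbhs_nbhs; split=> //; apply: closed_openC; exact: closed_closure.
  apply: filterS => y ncy j; rewrite /G; case: asboolP => // Oy.
  by exfalso; apply: ncy; exact: subset_closure.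
have pdG_out j x : ~ Omega x -> pd j (G j) x = 0.
  move=> /Gout gx; rewrite (@near_eq_pd R j (G j) (cst 0)) ?(@pd_cst R)//.
  by apply: filterS gx.
have GC j : C1_on setT (G j).
  apply: C1_on_local => x _; have [Ox|nOx] := pselect (Omega x).
    by exists Omega, (fun y => chi y * F j y); split=> //; [exact: C1_onM|exact: GO].
  exists [set y | forall j, G j y = 0]^°, (cst 0); split.
  - exact: open_interior.
  - exact: Gout.
  - exact: C1_on_cst.
  - by move=> y /interior_subset.
have pdG_in j x : Omega x -> pd j (G j) x = chi x * pd j (F j) x + F j x * pd j chi x.
  move=> Ox; have [dc _] := chiC x Ox; have [dF _] := FC j Ox.
  rewrite (@near_eq_pd R j (G j) (fun y => chi y * F j y)); last first.
    by near=> y; apply: GO; near: y; exact: open_nbhs_nbhs.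
  by rewrite pdM.
have meanG j : upmean M (pd j (G j)) d.
  apply: mean_pd_le => //.
  - by move=> x; have [] := GC j x I.
  - by move=> x; have [_] := GC j x I; exact.
  - move=> x Mx; rewrite /G; case: asboolP => // Ox.
    by have := OM x (subset_closure Ox); rewrite ltNge Mx.
have lower x : D * (`|x - x0| <= r)%R%:R <= \sum_j pd j (G j) x + flux Omega F chi x.
  rewrite /flux; case: asboolP => [Ox|nx]; last first.
    rewrite big1 => [|j _]; last exact: pdG_out.
    rewrite addr0; have [/P0O[]//|_] := boolP (`|x - x0| <= r).
    by rewrite mulr0.
  have -> : \sum_j pd j (G j) x = chi x * (\sum_j pd j (F j) x) + \sum_j F j x * pd j chi x.
    by rewrite mulr_sumr -big_split /=; apply: eq_bigr => j _; exact: pdG_in.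
  have := ler_norm (- (\sum_j F j x * pd j chi x)); rewrite normrN.
  have /andP[c0 c1] := chi01 x Ox.
  have := mulr_ge0 c0 (div0 x Ox).
  have [xr|_] := boolP (`|x - x0| <= r); last by rewrite mulr0; lra.
  have [_] := P0O x xr; rewrite mulr1 (chi1 x xr) mul1r; lra.
have x0r i : `|x0 i 0| + r <= M by have := vec_coord_le x0 i; lra.
have := mean_ball_ge M0 r0 x0r; rewrite -/k => kmean.
have total := upmeanD (upmean_sum (index_enum 'I_3) meanG) chid.
have [N [h1 h2]] : exists N, k <= mean M N (fun x => (`|x - x0| <= r)%R%:R) /\
    mean M N (fun x => D * (`|x - x0| <= r)%R%:R) <= \sum_(j < 3) d + d.
  have [N h] := filter_ex (filterI kmean (upmeanS lower total)); by exists N.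
have : D * k <= \sum_(j < 3) d + d by apply: le_trans h2; rewrite meanZ ler_pM2l.
rewrite sumr_const card_ord -mulr_natl /d; have : 0 < D * k by rewrite mulr_gt0.
lra.
Unshelve. all: by end_near. Qed.

End Divergence.

(** * Infinitesimal rigidity *)

Section Rigid.
Variable R : realType.
Implicit Types (x y z v : vec R) (u : vec R -> vec R).

Lemma derive_pd (f : vec R -> R) x v : differentiable f x ->
  'D_v f x = \sum_j v j 0 * pd j f x.
Proof.
move=> df; have -> : v = \sum_j v j 0 *: (delta_mx j 0 : vec R).
  apply/colP => i; rewrite summxE (bigD1 i)//= big1 ?addr0.
    by rewrite !mxE !eqxx mulr1.
  by move=> j ij; rewrite !mxE eq_sym (negbTE ij) mulr0.
rewrite deriveE// linear_sum; apply: eq_bigr => j _.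
rewrite linearZ /= /pd deriveE//; congr (_ * _).
rewrite summxE (bigD1 j)//= big1 ?addr0.
  by rewrite !mxE !eqxx mulr1.
by move=> i ij; rewrite !mxE eq_sym (negbTE ij) mulr0.
Qed.

Definition dotv x y : R := \sum_i x i 0 * y i 0.

(** A skew gradient annihilates the quadratic form of every direction, so along
    a segment the displacement has a constant component in the direction of the
    segment. *)
Lemma skew_grad_dot (V : set (vec R)) u x y : C1_on_mx V u ->
  (forall z, V z -> antisymmetric2 (grad u z)) ->
  (forall t : R, 0 <= t <= 1 -> V (y + t *: (x - y))) ->
  dotv (u x - u y) (x - y) = 0.
Proof.
move=> uC skew seg; set v := x - y.
have df z : V z -> differentiable (fun w => \sum_i u w i 0 * v i 0) z.
  move=> Vz; pose g i w := u w i 0 * v i 0.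
  rewrite (_ : (fun w => _) = \sum_i g i); last by apply/funext => w; rewrite fct_sumE.
  apply: differentiable_sum => i; apply: differentiableM => //.
  by have [] := uC i 0 z Vz.
have [t /andP[t0 t1]] := @line_MVT R (fun w => \sum_i u w i 0 * v i 0) y v 0 1 ltr01
  (fun t t01 => df _ (seg t t01)).
have Vt : V (y + t *: v) by apply: seg; rewrite !ltW.
rewrite scale1r scale0r addr0 subr0 mulr1 (_ : y + v = x); last by rewrite addrC subrK.
rewrite -sumrB => E; have -> : dotv (u x - u y) v = \sum_i (u x i 0 * v i 0 - u y i 0 * v i 0).
  by apply: eq_bigr => i _; rewrite !mxE mulrBl.
rewrite E derive_pd; last exact: df.
have pdf j : pd j (fun w => \sum_i u w i 0 * v i 0) (y + t *: v) =
    \sum_i grad u (y + t *: v) i j * v i 0.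
  pose g i w := u w i 0 * v i 0.
  have dg i : differentiable (g i) (y + t *: v).
    have [du _] := uC i 0 _ Vt.
    exact: (differentiableM du (differentiable_cst (v i 0) _)).
  rewrite (_ : (fun w => _) = \sum_i g i); last by apply/funext => w; rewrite fct_sumE.
  rewrite /pd derive_sum => [|i]; last exact: diff_derivable.
  apply: eq_bigr => i _; rewrite -/(pd j (g i) _) /g.
  rewrite (@pdM R j (fun w => u w i 0) (cst (v i 0)))//; last by have [] := uC i 0 _ Vt.
  by rewrite (@pd_cst R) mulr0 add0r [RHS]mulrC [grad u _ i j]mxE.
under eq_bigr do rewrite pdf mulr_sumr.
set S := (X in X = _); suff : S = - S by lra.
rewrite {1}/S exchange_big /S -sumrN; apply: eq_bigr => i _; rewrite -sumrN; apply: eq_bigr => j _ /=.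
have := skew _ Vt; rewrite /antisymmetric2 => /matrixP/(_ j i); rewrite [LHS]mxE [RHS]mxE => ->.
by ring.
Qed.

(** Polarizing [skew_grad_dot] gives [e h . k = - e k . h] for the increments [e]
    from the center; with [k] along the axes this exhibits [e] as linear and
    skew, for a displacement that is only C^1. *)
Lemma skew_grad_local u z (r : R) : 0 < r -> C1_on_mx (ball z r) u ->
  (forall y, ball z r y -> antisymmetric2 (grad u y)) ->
  exists a (W : tensor2 R), antisymmetric2 W /\ forall x, ball z r x -> u x = a + W *m x.
Proof.
move=> r0 uC skew.
have conv x y (t : R) : ball z r x -> ball z r y -> 0 <= t <= 1 -> ball z r (y + t *: (x - y)).
  rewrite -!ball_normE /= => xr yr /andP[t0 t1].
  have -> : z - (y + t *: (x - y)) = (1 - t) *: (z - y) + t *: (z - x).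
    by apply/colP => i; rewrite !mxE; ring.
  apply: le_lt_trans (ler_normD _ _) _; rewrite !normrZ (ger0_norm t0) ger0_norm ?subr_ge0//.
  have [->|tn0] := eqVneq t 0; first by rewrite subr0 mul1r mul0r addr0.
  have tp : 0 < t by rewrite lt_def tn0.
  rewrite (_ : r = (1 - t) * r + t * r); last by ring.
  by rewrite ler_ltD ?ltr_pM2l// ler_wpM2l ?subr_ge0// ltW.
pose e h := u (z + h) - u z.
have bz h : `|h| < r -> ball z r (z + h).
  by rewrite -ball_normE /= opprD addrA subrr sub0r normrN.
have ee h k : `|h| < r -> `|k| < r -> dotv (e h - e k) (h - k) = 0.
  move=> hr kr; have := @skew_grad_dot (ball z r) u (z + h) (z + k) uC skew
    (fun t => conv _ _ t (bz h hr) (bz k kr)).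
  have -> : u (z + h) - u (z + k) = e h - e k by rewrite /e opprB addrA subrK.
  by rewrite (_ : z + h - (z + k) = h - k)// opprD addrACA subrr add0r.
have e0 : e 0 = 0 by rewrite /e addr0 subrr.
have eh h : `|h| < r -> dotv (e h) h = 0.
  by move=> hr; have := ee h 0 hr; rewrite normr0 e0 !subr0; exact.
have dotB a b c d : dotv (a - b) (c - d) = dotv a c - dotv a d - dotv b c + dotv b d.
  by rewrite /dotv -!sumrB -big_split; apply: eq_bigr => i _ /=; rewrite !mxE; ring.
have polar h k : `|h| < r -> `|k| < r -> dotv (e h) k = - dotv (e k) h.
  move=> hr kr; have := ee h k hr kr; rewrite dotB eh// [dotv (e k) k]eh//.
  by lra.
pose s := r / 2; have s0 : 0 < s by rewrite divr_gt0.
pose E i : vec R := s *: delta_mx i 0.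
have Er i : `|E i| < r.
  rewrite vec_norm_lt//; apply/forallP => j; rewrite !mxE eqxx andbT.
  by case: (j == i); rewrite ?mulr1 ?mulr0 ?normr0// ger0_norm /s; lra.
have dotE a i : dotv a (E i) = s * a i 0.
  rewrite /dotv (bigD1 i)//= big1 ?addr0.
    by rewrite !mxE !eqxx mulr1 mulrC.
  by move=> j ji; rewrite !mxE (negbTE ji) /= !mulr0.
pose W : tensor2 R := \matrix_(i, j) (- s^-1 * e (E i) j 0).
have WE i j : W i j = - s^-1 * e (E i) j 0 by rewrite [LHS]mxE.
have eW h : `|h| < r -> e h = W *m h.
  move=> hr; apply/colP => i; apply: (@mulfI _ s); first by rewrite gt_eqF.
  rewrite -dotE polar ?Er// [in RHS]mxE /dotv mulr_sumr -sumrN; apply: eq_bigr => j _.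
  by rewrite WE; field; rewrite gt_eqF.
exists (u z - W *m z), W; split.
  apply/matrixP => i j; rewrite [LHS]mxE [RHS]mxE !WE.
  have := polar (E i) (E j) (Er i) (Er j); rewrite !dotE => h.
  apply: (@mulfI _ s); first by rewrite gt_eqF.
  apply: (@mulfI _ s); first by rewrite gt_eqF.
  have -> : s * (s * (- s^-1 * e (E j) i 0)) = - (s * e (E j) i 0) by field; rewrite gt_eqF.
  rewrite -h; by field; rewrite gt_eqF.
move=> x xr; have hr : `|x - z| < r by move: xr; rewrite -ball_normE /= distrC.
have := eW _ hr; rewrite /e (addrC z) subrK mulmxBr => /eqP; rewrite subr_eq => /eqP ->.
by rewrite [LHS]addrC [LHS]addrA [LHS]addrAC.
Qed.

Lemma affine_unique z (r : R) a b (W X : tensor2 R) : 0 < r ->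
  (forall x, ball z r x -> a + W *m x = b + X *m x) -> a = b /\ W = X.
Proof.
move=> r0 E; have WX : W = X.
  apply/matrixP => i j; pose s := r / 2; have s0 : 0 < s by rewrite divr_gt0.
  have h1 := E z (ballxx _ r0).
  have := E (z + s *: delta_mx j 0) _; rewrite -ball_normE /= opprD addrA subrr sub0r normrN => h.
  have : a + W *m (z + s *: delta_mx j 0) = b + X *m (z + s *: delta_mx j 0).
    apply: h; rewrite vec_norm_lt//; apply/forallP => k; rewrite !mxE eqxx andbT.
    by case: (k == j); rewrite ?mulr1 ?mulr0 ?normr0// ger0_norm /s; lra.
  rewrite !mulmxDr !addrA h1 => /addrI; rewrite -!scalemxAr => /(scalerI (lt0r_neq0 s0)).
  by rewrite -!colE => /colP/(_ i); rewrite !mxE.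
by split=> //; have := E z (ballxx _ r0); rewrite WX => /addIr.
Qed.

(** Infinitesimal rigidity: the locally rigid motions of [skew_grad_local]
    agree on overlaps, hence throughout a connected open set. *)
Lemma skew_grad_rigid (Omega : set (vec R)) u : open Omega -> connected Omega ->
  C1_on_mx Omega u -> (forall z, Omega z -> antisymmetric2 (grad u z)) ->
  exists a (W : tensor2 R), antisymmetric2 W /\ forall x, Omega x -> u x = a + W *m x.
Proof.
move=> oO cO uC skew.
have loc z : Omega z -> exists r a (W : tensor2 R), [/\ 0 < r, antisymmetric2 W &
    forall x, ball z r x -> u x = a + W *m x].
  move=> Oz; have /nbhs_ballP[r /= r0 rO] : nbhs z Omega by exact: open_nbhs_nbhs.
  have [a [W [Ws Wu]]] := @skew_grad_local u z r r0
    (fun i j => C1_on_sub rO (uC i j)) (fun y yr => skew y (rO y yr)).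
  by exists r, a, W; split.
have [[z Oz]|nO] := pselect (Omega !=set0); last first.
  exists 0, 0; split; first by rewrite /antisymmetric2 trmx0 oppr0.
  by move=> x Ox; exfalso; apply: nO; exists x.
have [r [a [W [r0 Ws Wu]]]] := loc z Oz.
exists a, W; split=> //.
pose C := [set x | u x = a + W *m x]^°.
suff <- : Omega `&` C = Omega by move=> x [_ /interior_subset].
apply: cO.
- by exists z; split=> //; apply/nbhs_ballP; exists r.
- by exists C => //; exact: open_interior.
- exists (closure (Omega `&` C)); first exact: closed_closure.
  apply/seteqP; split=> [x [Ox Cx]|x [Ox clx]].
    by split=> //; apply: subset_closure; split.
  split=> //; have [s [b [X [s0 Xs Xu]]]] := loc x Ox.
  have [q [[Oq Cq] xq]] := clx _ (nbhsx_ballx x s s0).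
  have : nbhs q (ball x s `&` [set x | u x = a + W *m x]).
    by apply: filterI => //; apply: open_nbhs_nbhs; split=> //; exact: ball_open.
  move=> /nbhs_ballP[t /= t0 tq].
  have [ab WX] : a = b /\ W = X.
    by apply: (affine_unique t0) => y /tq[/Xu <- <-].
  by apply/nbhs_ballP; exists s => // y /Xu; rewrite ab WX.
Qed.

End Rigid.

(** * Boundary values and normals *)

Section BoundaryLimits.
Variables (R : realType) (Omega : set (vec R)).
Implicit Types (x y z : vec R).

Lemma within_closure_proper x : closure Omega x -> ProperFilter (within Omega (nbhs x)).
Proof. by move=> cx; exact: within_nbhs_proper. Qed.

Lemma boundary_limit_unique (f : vec R -> R) x (a b : R) : closure Omega x ->
  f y @[y --> within Omega (nbhs x)] --> a ->
  f y @[y --> within Omega (nbhs x)] --> b -> a = b.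
Proof.
move=> cx fa fb; have PF := within_closure_proper cx.
exact: (cvg_unique _ fa fb).
Qed.

Lemma bval_entry m n (f : vec R -> 'M[R]_(m.+1, n.+1)) x l i j :
  bval Omega f x l -> f y i j @[y --> within Omega (nbhs x)] --> l i j.
Proof.
rewrite /bval => fl.
apply: (@cvg_comp _ _ _ f (fun A : 'M[R]_(m.+1, n.+1) => A i j) _ (nbhs l) _ fl).
exact: coord_continuous.
Qed.

Lemma cvg_within_continuous (f : vec R -> R) x : {for x, continuous f} ->
  f y @[y --> within Omega (nbhs x)] --> f x.
Proof. by move=> cf; apply: cvg_within_filter. Qed.

Lemma bounded_of_limits (f : vec R -> R) : compact (closure Omega) ->
  (forall x, closure Omega x -> exists l : R, f y @[y --> within Omega (nbhs x)] --> l) ->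
  exists2 B, 0 < B & forall x, Omega x -> `|f x| <= B.
Proof.
move=> cO lim; have [B B0 fB] : exists2 B, 0 < B &
    forall x, closure Omega x -> Omega x -> `|f x| <= B.
  apply: (@compact_induction R (closure Omega) (fun V => exists2 B, 0 < B &
    forall x, V x -> Omega x -> `|f x| <= B)) => //.
  - by exists 1.
  - move=> V W [B B0 fB] [C C0 fC]; exists (Num.max B C); first by rewrite lt_max B0.
    by move=> x [/fB fx|/fC fx] Ox; rewrite le_max fx ?orbT.
  - by move=> V W VW [B B0 fB]; exists B => // x /VW; exact: fB.
  - move=> x /lim[l fl]; exists [set y | Omega y -> `|f y| <= `|l| + 1].
      have /cvgrPdist_le/(_ 1 ltr01) := fl; rewrite near_withinE.
      apply: filterS => y h /h fy; rewrite -[f y](subrK l).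
      by apply: le_trans (ler_normD _ _) _; rewrite addrC lerD2l distrC.
    by exists (`|l| + 1) => //; rewrite ltr_wpDl.
by exists B => // x Ox; apply: fB => //; exact: subset_closure.
Qed.

End BoundaryLimits.

Section Normals.
Variables (R : realType) (Omega : set (vec R)).
Implicit Types (x y z v : vec R) (f rho : vec R -> R).

Lemma derive_lt0 f x v : differentiable f x -> 'D_v f x < 0 ->
  \forall h \near (0 : R)^'+, f (h *: v + x) < f x.
Proof.
move=> df D0; have [lim _] : derivable f x v /\ True by split=> //; exact: diff_derivable.
have {}lim : (fun h : R => h^-1 *: (f (h *: v + x) - f x)) @ 0^' --> 'D_v f x by [].
have lt : \forall h \near (0 : R)^', h^-1 *: (f (h *: v + x) - f x) < 0.
  exact: (cvgr_lt _ lim).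
have {}lt : \forall h \near (0 : R)^'+, h^-1 *: (f (h *: v + x) - f x) < 0.
  move: lt; rewrite !near_withinE; apply: filterS => h H h0; apply: H.
  by rewrite gt_eqF.
near=> h; have h0 : 0 < h by near: h; exact: nbhs_right_gt.
have : h^-1 *: (f (h *: v + x) - f x) < 0 by near: h.
by rewrite pmulr_rlt0 ?invr_gt0// subr_lt0.
Unshelve. all: by end_near. Qed.

Lemma near_line (V : set (vec R)) x v : nbhs x V -> \forall h \near (0 : R)^'+, V (h *: v + x).
Proof.
move=> xV; have cl : h *: v + x @[h --> (0 : R)] --> 0 *: v + x.
  by apply: cvgD; [apply: cvgZl; exact: cvg_id|exact: cvg_cst].
rewrite scale0r add0r in cl.
have : \forall h \near (0 : R), V (h *: v + x) by exact: cl.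
exact: cvg_within.
Qed.

(** Moving against the gradient enters the domain. *)
Lemma sgrad_closure (U : set (vec R)) rho z : open U -> C1_on U rho ->
  (forall y, U y -> (Omega y <-> rho y < 0)) -> U z -> rho z = 0 ->
  sgrad rho z != 0 -> closure Omega z.
Proof.
move=> oU rhoC rhoO Uz rz gz V zV; have [dr _] := rhoC z Uz.
have D0 : 'D_(- sgrad rho z) rho z < 0.
  rewrite derive_pd//.
  have -> : \sum_j (- sgrad rho z) j 0 * pd j rho z = - \sum_j (pd j rho z) ^+ 2.
    by rewrite -sumrN; apply: eq_bigr => j _; rewrite !mxE mulNr expr2.
  rewrite oppr_lt0 lt_def sumr_ge0 ?andbT => [|j _]; last exact: sqr_ge0.
  apply: contra gz; rewrite psumr_eq0 => [|j _]; last exact: sqr_ge0.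
  move=> /allP h; apply/eqP/colP => j; rewrite !mxE; apply/eqP.
  by have := h j (mem_index_enum _); rewrite /= sqrf_eq0.
have nU : nbhs z U by exact: open_nbhs_nbhs.
have F1 := derive_lt0 dr D0.
have F2 := near_line (- sgrad rho z) nU.
have F3 := near_line (- sgrad rho z) zV.
have [h [[h1 h2] h3]] := filter_ex (filterI (filterI F1 F2) F3).
by exists (h *: (- sgrad rho z) + z); split=> //; apply: (rhoO _ h2).2; rewrite -rz.
Qed.

(** The tangent plane, hence the direction of the gradient, is determined by
    the domain and not by the function defining it: a direction that decreases
    one defining function points into the domain and so cannot increase the
    other. *)
Lemma sgrad_parallel (U U' : set (vec R)) rho rho' z :
  [/\ open U, U z & C1_on U rho] -> (forall y, U y -> (Omega y <-> rho y < 0)) ->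
  rho z = 0 ->
  [/\ open U', U' z & C1_on U' rho'] -> (forall y, U' y -> (Omega y <-> rho' y < 0)) ->
  rho' z = 0 -> sgrad rho' z != 0 ->
  exists k : R, sgrad rho z = k *: sgrad rho' z.
Proof.
move=> [oU Uz rhoC] rhoO rz [oU' Uz' rhoC'] rhoO' rz' gz'.
set a := sgrad rho' z; set b := sgrad rho z.
have [dr _] := rhoC z Uz; have [dr' _] := rhoC' z Uz'.
have DE f v : differentiable f z -> 'D_v f z = dotv v (sgrad f z).
  by move=> df; rewrite derive_pd//; apply: eq_bigr => j _; rewrite mxE.
have cone v : dotv v a < 0 -> dotv v b <= 0.
  move=> va; rewrite leNgt; apply/negP => vb.
  have nd : 'D_v (fun y => - rho y) z < 0.
    have drv : derivable rho z v by exact: diff_derivable.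
    by rewrite [X in X < 0](deriveN drv) oppr_lt0 DE.
  have va' : 'D_v rho' z < 0 by rewrite DE.
  have ndr : differentiable (fun y => - rho y) z by exact: differentiableN.
  have nU : nbhs z U by exact: open_nbhs_nbhs.
  have nU' : nbhs z U' by exact: open_nbhs_nbhs.
  have F1 := derive_lt0 dr' va'.
  have F2 := near_line v nU'.
  have F3 := derive_lt0 ndr nd.
  have F4 := near_line v nU.
  have [h [[h1 h2] [h3 h4]]] := filter_ex (filterI (filterI F1 F2) (filterI F3 F4)).
  have : Omega (h *: v + z) by apply: (rhoO' _ h2).2; rewrite -rz'.
  by move=> /(rhoO _ h4); move: h3; rewrite rz oppr0; lra.
have dotC v w : dotv v w = dotv w v by apply: eq_bigr => i _; rewrite mulrC.
have dotD v w t c : dotv (v - t *: w) c = dotv v c - t * dotv w c.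
  by rewrite /dotv mulr_sumr -sumrB; apply: eq_bigr => i _; rewrite !mxE; ring.
have dot_ge0 v : 0 <= dotv v v by apply: sumr_ge0 => i _; rewrite -expr2 sqr_ge0.
have dot_eq0 v : dotv v v = 0 -> v = 0.
  move=> v0; apply/colP => i; rewrite mxE; apply/eqP; rewrite -sqrf_eq0 expr2.
  have /allP/(_ i (mem_index_enum _)) : all (fun i => v i 0 * v i 0 == 0) (index_enum 'I_3).
    have := psumr_eq0 (index_enum 'I_3) (P := xpredT) (F := fun i => v i 0 * v i 0).
    by rewrite -/(dotv v v) v0 eqxx => <- // j _; rewrite -expr2 sqr_ge0.
  by [].
have aa : 0 < dotv a a.
  by rewrite lt_def dot_ge0 andbT; apply: contra gz' => /eqP/dot_eq0 a0; exact/eqP.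
pose k := dotv b a / dotv a a; pose w := b - k *: a.
have wa : dotv w a = 0 by rewrite dotD /k divfK ?subrr// gt_eqF.
have wb : dotv w b = dotv w w.
  have E : dotv w w = dotv b w - k * dotv a w by exact: dotD.
  by rewrite E (dotC a) wa mulr0 subr0 dotC.
exists k; apply/eqP; rewrite -subr_eq0 -/w; apply/eqP/dot_eq0.
apply/eqP; rewrite eq_le dot_ge0 andbT leNgt; apply/negP => ww.
pose t := dotv w w / (2 * (`|dotv a b| + 1)).
have den : 0 < 2 * (`|dotv a b| + 1) by rewrite mulr_gt0// ltr_wpDl.
have t0 : 0 < t by rewrite divr_gt0.
have := cone (w - t *: a); rewrite (dotD w a t a) (dotD w a t b) wa wb sub0r oppr_lt0 mulr_gt0// => /(_ isT).
have : t * dotv a b <= dotv w w / 2.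
  apply: le_trans (_ : t * `|dotv a b| <= _); first by rewrite ler_pM2l// ler_norm.
  rewrite /t mulrAC ler_pdivrMr//; have := normr_ge0 (dotv a b); nra.
lra.
Qed.

End Normals.

(** * The energy identity *)

Section Energy.
Variables (R : realType) (Omega Gs Gu : set (vec R)) (n : vec R -> vec R).
Hypothesis hOmega : body Omega.
Hypothesis hGamma : boundary_partition Omega Gs Gu.
Hypothesis hn : forall x, regular_boundary Omega x -> outward_normal Omega x (n x).
Implicit Types (x y z : vec R) (d : vec R -> vec R) (s : vec R -> tensor2 R).

Definition mixed_boundary_values d s := forall x, boundary Omega x ->
  exists (l : vec R) (m : tensor2 R),
    [/\ forall i, d y i 0 @[y --> within Omega (nbhs x)] --> l i 0,
        forall i j, s y i j @[y --> within Omega (nbhs x)] --> m i j,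
        Gs x -> m *m n x = 0 & Gu x -> l = 0].

Variables (d : vec R -> vec R) (s : vec R -> tensor2 R).
Hypothesis dC : C1_on_mx Omega d.
Hypothesis sC : C1_on_mx Omega s.
Hypothesis bv : mixed_boundary_values d s.
Hypothesis div_s : forall x, Omega x -> div s x = 0.

(** The vector field [s^T d] of Green's identity. *)
Let F (j : 'I_3) y : R := \sum_i d y i 0 * s y i j.

Let oO : open Omega. Proof. by have [] := hOmega. Qed.

Let FC j : C1_on Omega (F j).
Proof. by apply: C1_on_sum => // i; apply: C1_onM; [|exact: dC|exact: sC]. Qed.

Let F_limit x : closure Omega x -> forall j, exists l : R, F j y @[y --> within Omega (nbhs x)] --> l.
Proof.
move=> cx j; have [Ox|nx] := pselect (Omega x).
  by exists (F j x); apply: cvg_within_continuous; exact: C1_on_continuous (FC j) Ox.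
have [l [m [dl sm _ _]]] := bv (conj cx nx).
exists (\sum_i l i 0 * m i j); apply: (@cvg_finite_sum R _ _ (within Omega (nbhs x))) => i.
exact: cvgM.
Qed.

Let compact_clO : compact (closure Omega).
Proof.
have [M M0 OM] := body_bound hOmega; apply: bounded_closed_compact_vec; last exact: closed_closure.
by exists M; split; [exact: num_real|move=> b Mb x /OM xM; exact/ltW/(lt_trans xM)].
Qed.

Let F_bounded : exists2 B, 0 < B & forall j x, Omega x -> `|F j x| <= B.
Proof.
have /boolp.choice[b bP] : forall j, exists b, 0 < b /\ forall x, Omega x -> `|F j x| <= b.
  move=> j; have [b b0 fb] := bounded_of_limits compact_clO (fun x cx => F_limit cx j).
  by exists b.
exists (1 + \sum_j b j).
  by rewrite ltr_pwDl// sumr_ge0// => j _; have [/ltW] := bP j.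
move=> j x Ox; have [_ /(_ x Ox)] := bP j => /le_trans; apply.
rewrite (bigD1 j)//= addrCA lerDl addr_ge0// sumr_ge0// => i _.
by have [/ltW] := bP i.
Qed.

(** On [Gu] the factor [d] tends to zero; on [Gs] the factor [s n] does, and the
    gradient of any defining function is parallel to [n]. *)
Let flux_zero_on_G (U : set (vec R)) rho z : open U -> C1_on U rho ->
  (forall y, U y -> (Omega y <-> rho y < 0)) -> U z -> rho z = 0 ->
  boundary Omega z -> (Gs `|` Gu) z ->
  \sum_j F j y * pd j rho y @[y --> within Omega (nbhs z)] --> (0 : R).
Proof.
move=> oU rhoC rhoO Uz rz bz Gz; have [l [m [dl sm ms lu]]] := bv bz.
have lim : \sum_j F j y * pd j rho y @[y --> within Omega (nbhs z)] -->
    \sum_j (\sum_i l i 0 * m i j) * pd j rho z.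
  apply: (@cvg_finite_sum R _ _ (within Omega (nbhs z))) => j; apply: cvgM.
    by apply: (@cvg_finite_sum R _ _ (within Omega (nbhs z))) => i; exact: cvgM.
  by apply: cvg_within_continuous; have [_] := rhoC z Uz; exact.
suff E : \sum_j (\sum_i l i 0 * m i j) * pd j rho z = 0 by rewrite E in lim.
case: Gz => [Gsz|Guz]; last first.
  by rewrite (lu Guz); apply: big1 => j _; rewrite big1 ?mul0r// => i _; rewrite mxE mul0r.
have [Gsr _ _ _ _] := hGamma.
have [U' [rho' [[oU' Uz' rhoC'] [rhoO' rz' gz' nz]]]] := hn (Gsr _ Gsz).
have [k gk] := sgrad_parallel (And3 oU Uz rhoC) rhoO rz (And3 oU' Uz' rhoC') rhoO' rz' gz'.
pose c := Num.sqrt (\sum_(i < 3) sgrad rho' z i 0 ^+ 2).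
have c0 : c != 0.
  rewrite gt_eqF// sqrtr_gt0 lt_def sumr_ge0 ?andbT => [|i _]; last exact: sqr_ge0.
  apply: contra gz'; rewrite psumr_eq0 => [|i _]; last exact: sqr_ge0.
  move=> /allP h; apply/eqP/colP => i; rewrite [RHS]mxE; apply/eqP.
  by have := h i (mem_index_enum _); rewrite /= sqrf_eq0.
have gn : sgrad rho z = (k * c) *: n z.
  by rewrite gk nz -/c scalerA mulfK.
have mg : m *m sgrad rho z = 0 by rewrite gn -scalemxAr ms// scaler0.
transitivity (\sum_i l i 0 * (m *m sgrad rho z) i 0); last first.
  by rewrite mg big1// => i _; rewrite mxE mulr0.
under eq_bigr do rewrite mulr_suml; rewrite exchange_big /=; apply: eq_bigr => i _.
rewrite [in RHS]mxE mulr_sumr; apply: eq_bigr => j _.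
by rewrite [sgrad _ _ _ _]mxE mulrA.
Qed.

(** The flux through a chart has a limit at every boundary point; were it nonzero
    at [z], the flux would be bounded away from zero near [z], hence also near a
    point of the dense set [Gs `|` Gu]. *)
Let no_flux (U : set (vec R)) rho z : open U -> C1_on U rho ->
  (forall y, U y -> (Omega y <-> rho y < 0)) -> U z -> rho z = 0 ->
  sgrad rho z != 0 ->
  \sum_j F j y * pd j rho y @[y --> within Omega (nbhs z)] --> (0 : R).
Proof.
move=> oU rhoC rhoO Uz rz gz.
have cz : closure Omega z := sgrad_closure oU rhoC rhoO Uz rz gz.
have nz : ~ Omega z by move=> /(rhoO _ Uz); rewrite rz ltxx.
have /boolp.choice[l lP] := F_limit cz.
set L := \sum_j l j * pd j rho z.
have lim : \sum_j F j y * pd j rho y @[y --> within Omega (nbhs z)] --> L.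
  apply: (@cvg_finite_sum R _ _ (within Omega (nbhs z))) => j; apply: cvgM => //.
  by apply: cvg_within_continuous; have [_] := rhoC z Uz; exact.
suff L0 : L = 0 by rewrite L0 in lim.
apply/eqP; apply: contrapT => /negP L0.
have L2 : 0 < `|L| / 2 by rewrite divr_gt0// normr_gt0.
have big : nbhs z [set y | Omega y -> `|L| / 2 < `|\sum_j F j y * pd j rho y|].
  have /cvgrPdist_lt/(_ _ L2) := lim; rewrite near_withinE; apply: filterS => y h /h.
  by have := lerB_dist L (\sum_j F j y * pd j rho y); lra.
have [_ _ _ bG _] := hGamma.
have clz : closure (Gs `|` Gu) z by rewrite -bG.
have nU : nbhs z U by exact: open_nbhs_nbhs.
have bigI : nbhs z [set y | Omega y -> `|L| / 2 < `|\sum_j F j y * pd j rho y|]^°.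
  exact: nbhs_interior.
have [w [Gw [wb wU]]] := clz _ (filterI bigI nU).
have [cw nw] : boundary Omega w by rewrite bG; exact: subset_closure.
have rw : rho w = 0.
  apply/eqP; rewrite eq_le; apply/andP; split; last first.
    by rewrite leNgt; apply/negP => /(rhoO _ wU).
  rewrite leNgt; apply/negP => rw.
  have pos : nbhs w [set y | 0 < rho y /\ U y].
    apply: filterI; last exact: open_nbhs_nbhs.
    exact: (cvgr_gt _ (C1_on_continuous rhoC wU)).
  by have [y [Oy [ry Uy]]] := cw _ pos; have := (rhoO _ Uy).1 Oy; lra.
have /cvgrPdist_lt/(_ _ L2) := flux_zero_on_G oU rhoC rhoO wU rw (conj cw nw) Gw.
rewrite near_withinE => small.
have [y [Oy [h1 h2]]] := cw _ (filterI small wb).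
by have := h1 Oy; have := h2 Oy; rewrite sub0r normrN; lra.
Qed.

(** As [div s = 0], the divergence of [s^T d] is the energy density. *)
Lemma energy_vanishes : (forall x, Omega x -> 0 <= dot2 (grad d x) (s x)) ->
  forall x, Omega x -> dot2 (grad d x) (s x) = 0.
Proof.
have divF x : Omega x -> \sum_j pd j (F j) x = dot2 (grad d x) (s x).
  move=> Ox; have ddif i : differentiable (fun y => d y i 0) x by have [] := dC i 0 Ox.
  have sdif i j : differentiable (fun y => s y i j) x by have [] := sC i j Ox.
  transitivity (\sum_j \sum_i (d x i 0 * pd j (fun y => s y i j) x + grad d x i j * s x i j)).
    apply: eq_bigr => j _; pose g i y := d y i 0 * s y i j.
    rewrite (_ : F j = \sum_i g i); last by apply/funext => y; rewrite fct_sumE.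
    have dg i : differentiable (g i) x by exact: differentiableM.
    rewrite /pd derive_sum => [|i]; last exact: diff_derivable.
    apply: eq_bigr => i _; rewrite -/(pd j (g i) x) /g pdM//; congr (_ + _).
    by rewrite mxE mulrC.
  under eq_bigr do rewrite big_split; rewrite big_split /= [X in X + _](_ : _ = 0) ?add0r.
    by rewrite exchange_big.
  rewrite exchange_big big1// => i _; rewrite -mulr_sumr.
  have /colP/(_ i) := div_s Ox; rewrite [LHS]mxE [RHS]mxE => ->.
  by rewrite mulr0.
move=> pos x Ox; rewrite -divF//; have [B B0 FB] := F_bounded.
apply: (divergence_vanishes hOmega B0 FC FB no_flux) => // y Oy.
by rewrite divF// pos.
Qed.

End Energy.

(** * Rigid motions vanishing on part of the boundary *)

Section RigidZero.
Variable R : realType.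
Implicit Types (x y z : vec R).

Let i0 : 'I_3 := ord0.
Let i1 : 'I_3 := lift ord0 ord0.
Let i2 : 'I_3 := lift ord0 (lift ord0 ord0).

Let sum3 (f : 'I_3 -> R) : \sum_i f i = f i0 + f i1 + f i2.
Proof. by rewrite !big_ord_recl big_ord0 addr0 addrA. Qed.

Let all3 (P : 'I_3 -> Prop) : P i0 -> P i1 -> P i2 -> forall i, P i.
Proof.
move=> p0 p1 p2 i; case: (unliftP ord0 i) => [j ->|->//].
case: (unliftP ord0 j) => [k ->|->//]; by rewrite [k]ord1.
Qed.

(** A nonzero skew tensor is the cross product with its axial vector, onto
    whose multiples its kernel is reduced. *)
Lemma skew_kernel_line (W : tensor2 R) : antisymmetric2 W -> W != 0 ->
  exists w : vec R, forall v, W *m v = 0 -> exists s : R, v = s *: w.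
Proof.
move=> /matrixP skew W0.
have W_tr i j : W j i = - W i j by have := skew i j; rewrite !mxE.
have diag i : W i i = 0 by have := W_tr i i; lra.
pose w : vec R := \col_i (if i == i0 then W i2 i1 else if i == i1 then W i0 i2 else W i1 i0).
have w0 : w i0 0 = W i2 i1 by rewrite mxE.
have w1 : w i1 0 = W i0 i2 by rewrite mxE.
have w2 : w i2 0 = W i1 i0 by rewrite mxE.
exists w => v Wv.
have row i : W i i0 * v i0 0 + W i i1 * v i1 0 + W i i2 * v i2 0 = 0.
  by have /colP/(_ i) := Wv; rewrite !mxE sum3.
have := row i0; have := row i1; have := row i2.
rewrite !diag (W_tr i2 i1) (W_tr i0 i2) (W_tr i1 i0).
set a := W i2 i1 in w0 *; set b := W i0 i2 in w1 *; set c := W i1 i0 in w2 *.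
move=> r2 r1 r0.
have cancel (p t u : R) : p != 0 -> p * (t / p * u) = t * u by move=> ?; field.
have [c0|cn0] := eqVneq c 0; last first.
  exists (v i2 0 / c); apply/colP; apply: all3; rewrite [RHS]mxE ?w0 ?w1 ?w2.
  - apply: (@mulfI _ c) => //; rewrite cancel//; lra.
  - apply: (@mulfI _ c) => //; rewrite cancel//; lra.
  - by rewrite divfK.
have [b0|bn0] := eqVneq b 0; last first.
  exists (v i1 0 / b); apply/colP; apply: all3; rewrite [RHS]mxE ?w0 ?w1 ?w2.
  - apply: (@mulfI _ b) => //; rewrite cancel//; lra.
  - by rewrite divfK.
  - apply: (@mulfI _ b) => //; rewrite cancel//; lra.
have [a0|an0] := eqVneq a 0; last first.
  exists (v i0 0 / a); apply/colP; apply: all3; rewrite [RHS]mxE ?w0 ?w1 ?w2.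
  - by rewrite divfK.
  - apply: (@mulfI _ a) => //; rewrite cancel//; lra.
  - apply: (@mulfI _ a) => //; rewrite cancel//; lra.
exfalso; move/eqP: W0; apply; apply/matrixP => i j; rewrite [RHS]mxE.
move: i; apply: all3; move: j; apply: all3; rewrite ?diag//.
- by rewrite W_tr -/c c0 oppr0.
- by rewrite W_tr -/a a0 oppr0.
- by rewrite W_tr -/b b0 oppr0.
Qed.

(** The zeros of [a + W z] differ by elements of the kernel of [W], so they would
    be collinear if [W] were not zero. *)
Lemma rigid_noncollinear_eq0 (W : tensor2 R) (a : vec R) (G : set (vec R)) :
  antisymmetric2 W -> ~ collinear G -> (forall z, G z -> a + W *m z = 0) ->
  a = 0 /\ W = 0.
Proof.
move=> skew ncol aW.
have [[p Gp]|nG] := pselect (G !=set0); last first.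
  by exfalso; apply: ncol; exists 0, 0 => x Gx; exfalso; apply: nG; exists x.
have W0 : W = 0.
  apply/eqP; apply: contrapT => /negP W0; have [w ker] := skew_kernel_line skew W0.
  apply: ncol; exists p, w => x Gx; have [|s xs] := ker (x - p).
    rewrite mulmxBr; apply/eqP; rewrite subr_eq0; apply/eqP.
    by apply: (@addrI _ a); rewrite !aW.
  by exists s; rewrite -xs addrC subrK.
by split=> //; have := aW p Gp; rewrite W0 mul0mx addr0.
Qed.

Lemma skew_grad_eq0 (Omega G : set (vec R)) (u : vec R -> vec R) :
  open Omega -> connected Omega -> C1_on_mx Omega u ->
  (forall z, Omega z -> antisymmetric2 (grad u z)) ->
  G `<=` closure Omega -> ~ collinear G ->
  (forall z i, G z -> u y i 0 @[y --> within Omega (nbhs z)] --> (0 : R)) ->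
  forall x, Omega x -> u x = 0.
Proof.
move=> oO cO uC skew GO ncol uG.
have [a [W [Ws Wu]]] := skew_grad_rigid oO cO uC skew.
have [a0 W0] : a = 0 /\ W = 0.
  apply: (rigid_noncollinear_eq0 Ws ncol) => z Gz; apply/colP => i; rewrite [RHS]mxE.
  have aff : a i 0 + \sum_j W i j * y j 0 @[y --> within Omega (nbhs z)] -->
      a i 0 + \sum_j W i j * z j 0.
    apply: (@cvgD _ _ _ (within Omega (nbhs z))); first exact: cvg_cst.
    apply: (@cvg_finite_sum R _ _ (within Omega (nbhs z))) => j.
    apply: cvgM; first exact: cvg_cst.
    by apply: cvg_within_continuous; exact: coord_continuous.
  have -> : (a + W *m z) i 0 = a i 0 + \sum_j W i j * z j 0 by rewrite !mxE.
  apply: (boundary_limit_unique (GO _ Gz) _ (uG z i Gz)).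
  apply: cvg_trans aff; apply: near_eq_cvg; rewrite near_withinE; apply: nearW => y Oy.
  by rewrite Wu// !mxE.
by move=> x Ox; rewrite Wu// a0 W0 mul0mx addr0.
Qed.

End RigidZero.

(** * Tensor algebra *)

Section TensorAlgebra.
Variable R : realType.
Implicit Types (C : tensor4 R) (e f : tensor2 R).

Lemma tappB C e f : tapp C (e - f) = tapp C e - tapp C f.
Proof.
apply/matrixP => i j; rewrite !mxE -sumrB; apply: eq_bigr => k _.
by rewrite -sumrB; apply: eq_bigr => l _; rewrite !mxE mulrBr.
Qed.

Lemma tapp0 C : tapp C 0 = 0.
Proof. by have := tappB C 0 0; rewrite !subrr. Qed.

Lemma tapp_sympart C e : (forall i j k l, C i j k l = C i j l k) ->
  tapp C (sympart e) = tapp C e.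
Proof.
move=> Csym; apply/matrixP => i j; rewrite !mxE.
transitivity (2^-1 * (\sum_k \sum_l C i j k l * e k l + \sum_k \sum_l C i j k l * e l k)).
  rewrite -big_split mulr_sumr; apply: eq_bigr => k _ /=.
  rewrite -big_split mulr_sumr; apply: eq_bigr => l _ /=; rewrite !mxE; ring.
have -> : \sum_k \sum_l C i j k l * e l k = \sum_k \sum_l C i j k l * e k l.
  rewrite exchange_big; apply: eq_bigr => k _; apply: eq_bigr => l _ /=.
  by rewrite Csym.
by field.
Qed.

Lemma tapp_symmetric C e : (forall i j k l, C i j k l = C j i k l) ->
  symmetric2 (tapp C e).
Proof.
move=> Csym; apply/matrixP => i j; rewrite !mxE.
by apply: eq_bigr => k _; apply: eq_bigr => l _; rewrite Csym.
Qed.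

Lemma sympart_symmetric e : symmetric2 (sympart e).
Proof. by apply/matrixP => i j; rewrite !mxE addrC. Qed.

Lemma symmetric2B e f : symmetric2 e -> symmetric2 f -> symmetric2 (e - f).
Proof. by rewrite /symmetric2 linearB /= => -> ->. Qed.

Lemma sympartB e f : sympart (e - f) = sympart e - sympart f.
Proof. by apply/matrixP => i j; rewrite !mxE; ring. Qed.

Lemma skewpartB e f : skewpart (e - f) = skewpart e - skewpart f.
Proof. by apply/matrixP => i j; rewrite !mxE; ring. Qed.

Lemma sympart_skewpart e : sympart e + skewpart e = e.
Proof. by apply/matrixP => i j; rewrite !mxE; field. Qed.

Lemma skewpart_antisymmetric e : antisymmetric2 (skewpart e).
Proof. by apply/matrixP => i j; rewrite !mxE; ring. Qed.

Lemma sympart_eq0 e : sympart e = 0 -> antisymmetric2 e.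
Proof.
move=> s0; apply/matrixP => i j; have /matrixP/(_ i j) := s0; rewrite !mxE; lra.
Qed.

Lemma sympart_id e : symmetric2 e -> sympart e = e.
Proof.
by move=> es; apply/matrixP => i j; have /matrixP/(_ i j) := es; rewrite !mxE => ->; field.
Qed.

Lemma sympart_skew0 e : sympart (skewpart e) = 0.
Proof. by apply/matrixP => i j; rewrite !mxE; ring. Qed.

Lemma dot2_sympart e f : symmetric2 f -> dot2 e f = dot2 (sympart e) f.
Proof.
move=> fs; transitivity (2^-1 * (dot2 e f + dot2 e^T f)).
  have -> : dot2 e^T f = dot2 e f.
    rewrite /dot2 exchange_big; apply: eq_bigr => i _; apply: eq_bigr => j _ /=.
    by rewrite mxE -{1}fs mxE.
  by field.
rewrite /dot2 -big_split mulr_sumr; apply: eq_bigr => i _ /=.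
by rewrite -big_split mulr_sumr; apply: eq_bigr => j _ /=; rewrite !mxE; ring.
Qed.

(** Exchanging the index pairs leaves the quadratic form unchanged, so that the
    positive definiteness of [C] serves for [C^T] too. *)
Lemma dot2_ttr C e : dot2 e (tapp (ttr C) e) = dot2 e (tapp C e).
Proof.
have E D : dot2 e (tapp D e) = \sum_(p : 'I_3 * 'I_3) \sum_(q : 'I_3 * 'I_3)
    e p.1 p.2 * (D p.1 p.2 q.1 q.2 * e q.1 q.2).
  rewrite -(pair_bigA _ (fun i j => \sum_(q : 'I_3 * 'I_3) e i j * (D i j q.1 q.2 * e q.1 q.2))).
  apply: eq_bigr => i _; apply: eq_bigr => j _ /=.
  rewrite -(pair_bigA _ (fun k l => e i j * (D i j k l * e k l))) mxE mulr_sumr.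
  by apply: eq_bigr => k _; rewrite mulr_sumr.
rewrite !E exchange_big; apply: eq_bigr => p _; apply: eq_bigr => q _ /=.
by rewrite /ttr; ring.
Qed.

(** Positive definiteness concerns symmetric tensors only; the minor symmetries
    let it see the symmetric part of an arbitrary tensor. *)
Lemma energy_density C e : minor_symmetric C -> positive_definite C ->
  0 <= dot2 e (tapp C e) /\ (dot2 e (tapp C e) = 0 -> sympart e = 0).
Proof.
move=> Cm Cp; rewrite -(@tapp_sympart C e); last by move=> i j k l; have [] := Cm i j k l.
rewrite dot2_sympart; last by apply: tapp_symmetric => i j k l; have [] := Cm i j k l.
have [->|s0] := eqVneq (sympart e) 0.
  split=> //; rewrite tapp0 /dot2 sumr_ge0// => i _; rewrite sumr_ge0// => j _.
  by rewrite !mxE mulr0.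
have pos := Cp _ (sympart_symmetric e) s0.
by split; [exact: ltW|move=> E; move: pos; rewrite E ltxx].
Qed.

End TensorAlgebra.

(** * Differences of fields and uniqueness *)

Section FieldDifferences.
Variables (R : realType) (Omega : set (vec R)).
Hypothesis oO : open Omega.
Implicit Types (x : vec R).

Lemma C1_on_mxB m n (f g : vec R -> 'M[R]_(m, n)) : C1_on_mx Omega f -> C1_on_mx Omega g ->
  C1_on_mx Omega (fun y => f y - g y).
Proof.
move=> fC gC i j; rewrite (_ : (fun y => _) = fun y => f y i j - g y i j).
  exact: C1_onB.
by apply/funext => y; rewrite !mxE.
Qed.

Lemma gradB (f g : vec R -> vec R) x : C1_on_mx Omega f -> C1_on_mx Omega g -> Omega x ->
  grad (fun y => f y - g y) x = grad f x - grad g x.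
Proof.
move=> fC gC Ox; apply/matrixP => i j; rewrite !mxE.
rewrite (_ : (fun y => (f y - g y) i 0) = fun y => f y i 0 - g y i 0).
  by rewrite pdB//; [have [] := fC i 0 x Ox|have [] := gC i 0 x Ox].
by apply/funext => y; rewrite !mxE.
Qed.

Lemma divB (f g : vec R -> tensor2 R) x : C1_on_mx Omega f -> C1_on_mx Omega g -> Omega x ->
  div (fun y => f y - g y) x = div f x - div g x.
Proof.
move=> fC gC Ox; apply/colP => i; rewrite !mxE -sumrB; apply: eq_bigr => j _.
rewrite (_ : (fun y => (f y - g y) i j) = fun y => f y i j - g y i j).
  by rewrite pdB//; [have [] := fC i j x Ox|have [] := gC i j x Ox].
by apply/funext => y; rewrite !mxE.
Qed.

Lemma grad_eq0 (f : vec R -> vec R) x : (forall y, Omega y -> f y = 0) -> Omega x ->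
  grad f x = 0.
Proof.
move=> f0 Ox; apply/matrixP => i j; rewrite !mxE.
rewrite (@near_eq_pd R j _ (cst 0)) ?(@pd_cst R)//.
by near=> y; rewrite f0 ?mxE//; near: y; exact: open_nbhs_nbhs.
Unshelve. all: by end_near. Qed.

Lemma within_closure_limit m n (f : vec R -> 'M[R]_(m.+1, n.+1)) x :
  {within closure Omega, continuous f} -> closure Omega x -> bval Omega f x (f x).
Proof.
move=> /subspace_continuousP fc cx; apply: cvg_trans (fc x cx).
by apply: cvg_fmap2; apply: within_subset; exact: subset_closure.
Qed.

Lemma eq_on_closure m n (f g : vec R -> 'M[R]_(m.+1, n.+1)) :
  {within closure Omega, continuous f} -> {within closure Omega, continuous g} ->
  (forall x, Omega x -> f x = g x) -> forall x, closure Omega x -> f x = g x.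
Proof.
move=> fc gc fg x cx; apply/matrixP => i j.
have fl := @bval_entry R Omega _ _ f x _ i j (within_closure_limit fc cx).
have gl := @bval_entry R Omega _ _ g x _ i j (within_closure_limit gc cx).
apply: (@boundary_limit_unique R Omega (fun y => f y i j) x _ _ cx fl).
apply: cvg_trans gl.
by apply: near_eq_cvg; rewrite near_withinE; apply: nearW => y Oy; rewrite fg.
Qed.

Lemma bvalB_entry m n (f g : vec R -> 'M[R]_(m.+1, n.+1)) x l k i j :
  bval Omega f x l -> bval Omega g x k ->
  (f y - g y) i j @[y --> within Omega (nbhs x)] --> (l - k) i j.
Proof.
move=> fl gk; have fli := @bval_entry R Omega _ _ f x _ i j fl.
have gki := @bval_entry R Omega _ _ g x _ i j gk.
rewrite (_ : (fun y => _) = fun y => f y i j - g y i j).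
  by rewrite !mxE; exact: cvgB.
by apply/funext => y; rewrite !mxE.
Qed.

Lemma bval_unique m n (f : vec R -> 'M[R]_(m.+1, n.+1)) x l k :
  closure Omega x -> bval Omega f x l -> bval Omega f x k -> l = k.
Proof.
move=> cx fl fk; apply/matrixP => i j.
have fli := @bval_entry R Omega _ _ f x _ i j fl.
exact: (boundary_limit_unique cx fli (@bval_entry R Omega _ _ f x _ i j fk)).
Qed.

Lemma bval_mulmx (s : vec R -> tensor2 R) x (v l : vec R) (m : tensor2 R) :
  closure Omega x -> bval Omega s x m -> bval Omega (fun y => s y *m v) x l -> m *m v = l.
Proof.
move=> cx sm svl; apply/colP => i.
apply: (boundary_limit_unique cx _ (@bval_entry R Omega _ _ _ x _ i 0 svl)).
rewrite (_ : (fun y => _) = fun y => \sum_j s y i j * v j 0); last first.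
  by apply/funext => y; rewrite mxE.
rewrite mxE; apply: (@cvg_finite_sum R _ _ (within Omega (nbhs x))) => j.
apply: cvgM; last exact: cvg_cst.
exact: bval_entry sm.
Qed.

End FieldDifferences.

Theorem proposition3p2 (R : realType)
  (Omega Gs Gu : set (vec R)) (n : vec R -> vec R)
  (C A Ainv : vec R -> tensor4 R)
  (ubar : vec R -> vec R) (Ebar Wbar : vec R -> tensor2 R)
  (b ub t lamb tau : vec R -> vec R)
  (K : (vec R -> vec R) -> (vec R -> tensor2 R) -> Prop)
  (hOmega : body Omega)
  (hGamma : boundary_partition Omega Gs Gu)
  (hn : forall x, regular_boundary Omega x -> outward_normal Omega x (n x))
  (hCminor : forall x, Omega x -> minor_symmetric (C x))
  (hCpos : forall x, Omega x -> positive_definite (C x))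
  (hAmajor : forall x, Omega x -> major_symmetric (A x))
  (hApos : forall x, Omega x -> positive_definite (A x))
  (hAinv : forall x, Omega x -> inverse_on_sym (A x) (Ainv x))
  (hEbar : forall x, Omega x -> symmetric2 (Ebar x))
  (hWbar : forall x, Omega x -> antisymmetric2 (Wbar x))
  (hKreg : forall lam mu, K lam mu ->
     classical_pair Omega C Ainv ubar Ebar lam mu)
  (hKdiff : forall lam1 mu1 lam2 mu2, K lam1 mu1 -> K lam2 mu2 ->
     difference_conditions Omega Gs Gu n C Ainv
       (fun x => lam1 x - lam2 x) (fun x => mu1 x - mu2 x)) :
  forall lam1 mu1 lam2 mu2, K lam1 mu1 -> K lam2 mu2 ->
    dual_solution Omega Gs Gu n C Ainv ubar Ebar Wbar b ub t lamb tau lam1 mu1 ->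
    dual_solution Omega Gs Gu n C Ainv ubar Ebar Wbar b ub t lamb tau lam2 mu2 ->
    forall x, closure Omega x -> lam1 x = lam2 x /\ mu1 x = mu2 x.
Proof.
move=> lam1 mu1 lam2 mu2 K1 K2 [[eq1 comp1] [u1 t1 l1 m1]] [[eq2 comp2] [u2 t2 l2 m2]].
have [[lamC1 lamc1] [muC1 muc1] [dC1 dbv1] [sC1 sbv1]] := hKreg _ _ K1.
have [[lamC2 lamc2] [muC2 muc2] [dC2 dbv2] [sC2 sbv2]] := hKreg _ _ K2.
have [oO cO _ _] := hOmega.
have [Gsr GuO _ _ ncol] := hGamma.
pose d1 := dual_displacement ubar mu1; pose d2 := dual_displacement ubar mu2.
pose s1 := dual_stress C Ainv Ebar lam1 mu1; pose s2 := dual_stress C Ainv Ebar lam2 mu2.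
pose E x := dual_strain C Ainv Ebar lam1 mu1 x - dual_strain C Ainv Ebar lam2 mu2 x.
pose dlam x := lam1 x - lam2 x; pose dmu x := mu1 x - mu2 x.
pose mis x := sym_mismatch C lam1 mu1 x - sym_mismatch C lam2 mu2 x.
have C_left x : Omega x -> forall i j k l, C x i j k l = C x j i k l.
  by move=> Ox i j k l; have [] := hCminor x Ox i j k l.
have C_right x : Omega x -> forall i j k l, C x i j k l = C x i j l k.
  by move=> Ox i j k l; have [] := hCminor x Ox i j k l.
have mis_sym x : Omega x -> symmetric2 (mis x).
  move=> Ox; have trC e : symmetric2 (tapp (ttr (C x)) e).
    by apply: tapp_symmetric => i j k l; exact: C_right.
  by apply: symmetric2B; apply: symmetric2B => //; exact: sympart_symmetric.
have EE x : E x = - tapp (Ainv x) (mis x).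
  by rewrite /E /dual_strain /mis tappB [RHS]opprB [X in _ + X]opprB addrC addrA subrK.
have E_sym x : Omega x -> symmetric2 (E x).
  move=> Ox; have [_ h _ _] := hAinv x Ox _ (mis_sym x Ox).
  by rewrite /symmetric2 EE linearN /= h.
have sE x : s1 x - s2 x = tapp (C x) (E x) by rewrite /s1 /s2 /dual_stress -tappB.
have gradd x : Omega x -> grad (fun y => d1 y - d2 y) x = E x - skewpart (dmu x).
  move=> Ox; rewrite (gradB dC1 dC2 Ox).
  have := comp1 x Ox; have := comp2 x Ox; rewrite /dual_rotation -/d1 -/d2.
  move=> /eqP; rewrite subr_eq add0r subr_eq => /eqP ->.
  move=> /eqP; rewrite subr_eq add0r subr_eq => /eqP ->.
  by rewrite /E /dmu skewpartB; apply/matrixP => i j; rewrite !mxE; ring.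
have bdC := C1_on_mxB oO dC1 dC2; have bsC := C1_on_mxB oO sC1 sC2.
have cGs x : Gs x -> closure Omega x.
  move=> /Gsr[v [U [rho [[oU Ux rhoC] [rhoO rx gx _]]]]].
  exact: (sgrad_closure oU rhoC rhoO Ux rx gx).
have cGu x : Gu x -> closure Omega x by move=> /GuO[].
(* The rotation does not contribute, because the stress is symmetric. *)
have density x : Omega x -> dot2 (grad (fun y => d1 y - d2 y) x) (s1 x - s2 x) =
    dot2 (E x) (tapp (C x) (E x)).
  move=> Ox; rewrite sE gradd// dot2_sympart; last exact: tapp_symmetric (C_left x Ox).
  by rewrite sympartB sympart_skew0 subr0 sympart_id//; exact: E_sym.
have E0 x : Omega x -> E x = 0.
  move=> Ox; have [_ pos] := energy_density (E x) (hCminor x Ox) (hCpos x Ox).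
  rewrite -(sympart_id (E_sym x Ox)); apply: pos; rewrite -density//.
  apply: (energy_vanishes hOmega hGamma hn bdC bsC) => // [z bz|z Oz|z Oz].
  - have [l1' dl1] := dbv1 z bz; have [l2' dl2] := dbv2 z bz.
    have [m1' sm1] := sbv1 z bz; have [m2' sm2] := sbv2 z bz.
    exists (l1' - l2'), (m1' - m2'); split.
    + by move=> i; exact: bvalB_entry.
    + by move=> i j; exact: bvalB_entry.
    + move=> Gz; rewrite mulmxBl (bval_mulmx (cGs _ Gz) sm1 (t1 z Gz)).
      by rewrite (bval_mulmx (cGs _ Gz) sm2 (t2 z Gz)) subrr.
    + move=> Gz; rewrite (bval_unique (cGu _ Gz) dl1 (u1 z Gz)).
      by rewrite (bval_unique (cGu _ Gz) dl2 (u2 z Gz)) subrr.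
  - have flip (p q : vec R) : - p - q = 0 -> p = - q.
      by move=> /eqP; rewrite subr_eq0 => /eqP <-; rewrite opprK.
    have e1 : div s1 z = - b z by apply: flip; exact: eq1.
    have e2 : div s2 z = - b z by apply: flip; exact: eq2.
    transitivity (div s1 z - div s2 z); first exact: (divB sC1 sC2 Oz).
    apply: etrans (f_equal2 (fun p q => p - q) e1 e2) _.
    exact: subrr.
  - by rewrite density//; have [] := energy_density (E z) (hCminor z Oz) (hCpos z Oz).
have d0 x : Omega x -> d1 x - d2 x = 0.
  apply: (skew_grad_eq0 oO cO bdC _ cGu ncol) => [z Oz|z i Gz].
    rewrite gradd// E0// sub0r /antisymmetric2 linearN /=.
    by rewrite (skewpart_antisymmetric (dmu z)).
  have := bvalB_entry (i := i) (j := 0) (u1 z Gz) (u2 z Gz).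
  by rewrite subrr mxE.
have skew0 x : Omega x -> skewpart (dmu x) = 0.
  by move=> Ox; have := gradd x Ox; rewrite E0// sub0r (grad_eq0 oO d0 Ox) => /esym/eqP; rewrite oppr_eq0 => /eqP.
have mis0 x : Omega x -> mis x = 0.
  move=> Ox; have [_ _ <- _] := hAinv x Ox _ (mis_sym x Ox).
  have := E0 x Ox; rewrite EE => /eqP; rewrite oppr_eq0 => /eqP ->.
  exact: tapp0.
(* [Ainv] is injective on symmetric tensors, so the symmetric part of [dmu] is
   [C^T grad dlam]; its skew part has just been shown to vanish. *)
have dmuE x : Omega x -> dmu x = tapp (ttr (C x)) (grad dlam x).
  have swap (p q r q' : tensor2 R) : p - q - (r - q') = 0 -> p - r = q - q'.
    by move=> h; apply/matrixP => i j; have /matrixP/(_ i j) := h; rewrite !mxE; lra.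
  move=> Ox; rewrite -[LHS]sympart_skewpart skew0// addr0 sympartB.
  apply: etrans (swap _ _ _ _ (mis0 x Ox)) _; rewrite -tappB; congr (tapp _ _).
  exact/esym/gradB.
have blC := C1_on_mxB oO lamC1 lamC2; have bmC := C1_on_mxB oO muC1 muC2.
have div0 x : Omega x -> div dmu x = 0.
  move=> Ox; rewrite (divB muC1 muC2 Ox); have /eqP := d0 x Ox.
  by rewrite /d1 /d2 /dual_displacement subr_eq0 => /eqP/addrI/oppr_inj ->; rewrite subrr.
(* [dlam] and [dmu] now play the roles of displacement and stress. *)
have density2 x : Omega x ->
    dot2 (grad dlam x) (dmu x) = dot2 (grad dlam x) (tapp (C x) (grad dlam x)).
  by move=> Ox; rewrite dmuE// dot2_ttr.
have sym0 x : Omega x -> sympart (grad dlam x) = 0.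
  move=> Ox; have [_ pos] := energy_density (grad dlam x) (hCminor x Ox) (hCpos x Ox).
  apply: pos; rewrite -density2//.
  apply: (energy_vanishes hOmega hGamma hn blC bmC) => // [z [cz nz]|z Oz]; last first.
    by rewrite density2//; have [] := energy_density (grad dlam z) (hCminor z Oz) (hCpos z Oz).
  exists (dlam z), (dmu z); split.
  - by move=> i; apply: bvalB_entry; exact: within_closure_limit.
  - by move=> i j; apply: bvalB_entry; exact: within_closure_limit.
  - by move=> Gz; rewrite mulmxBl m1// m2// subrr.
  - by move=> Gz; rewrite /dlam l1// l2// subrr.
have lam0 x : Omega x -> lam1 x = lam2 x.
  move=> Ox; apply/eqP; rewrite -subr_eq0; apply/eqP.
  apply: (skew_grad_eq0 oO cO blC _ cGu ncol) => // [z Oz|z i Gz].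
    exact/sympart_eq0/sym0.
  have := bvalB_entry (i := i) (j := 0) (within_closure_limit lamc1 (cGu z Gz))
    (within_closure_limit lamc2 (cGu z Gz)).
  by rewrite l1// l2// subrr mxE.
have mu0 x : Omega x -> mu1 x = mu2 x.
  move=> Ox; apply/eqP; rewrite -subr_eq0; apply/eqP; rewrite -/(dmu x) dmuE//.
  rewrite -tapp_sympart ?sym0 ?tapp0// => i j k l.
  by rewrite /ttr C_left.
by move=> x cx; split; [exact: eq_on_closure lamc1 lamc2 lam0 x cx|exact: eq_on_closure muc1 muc2 mu0 x cx].
Qed.
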